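(* Let $n\ge3$ and let $$h=x_2^2x_1^2x_2^2+x_1^2x_2^2x_1^2+x_3^6-3x_1x_2x_3^2x_2x_1\in\mathbb R\langle x\rangle.$$ Then $h\in\overline{\mathcal K}\setminus\mathcal K$, where $\overline{\mathcal K}$ is the closure of $\mathcal K$ in the finest locally convex topology on $\mathbb R\langle x\rangle_{\rm sa}$.
   Context: $\mathbb R\langle x\rangle$ is the free unital associative $\mathbb R$-algebra on freely noncommuting variables $x_1,\dots,x_n$, with the involution $*$ (an $\mathbb R$-linear anti-automorphism) determined by $x_j^*=x_j$; $\mathbb R\langle x\rangle_{\rm sa}=\{p: p^*=p\}$. $\mathcal A=\mathbb R\langle x_1,\dots,x_n,(1+x_1^2)^{-1},\dots,(1+x_n^2)^{-1}\rangle$ is the $*$-subalgebra, generated by the listed elements, of the free skew field (universal skew field of fractions of $\mathbb R\langle x\rangle$); equivalently, $\mathcal A$ is the free product of $n$ copies of the commutative algebra $\mathbb R[t,\frac1{1+t^2}]$, with involution fixing all $x_j$. There is a natural embedding $\mathbb R\langle x\rangle\subset\mathcal A$. $\Sigma^2\mathcal A$ is the set of finite sums $\sum_i b_ib_i^*$ with $b_i\in\mathcal A$, and $[\mathcal A,\mathcal A]$ is the linear span of all $b_1b_2-b_2b_1$ with $b_1,b_2\in\mathcal A$. The convex cone $\mathcal K$ is $\mathcal K=(\Sigma^2\mathcal A+[\mathcal A,\mathcal A])\cap\mathbb R\langle x\rangle_{\rm sa}$. *)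

(* Defs.v *)
From HB Require Import structures.
From mathcomp Require Import all_boot all_order all_algebra.
From mathcomp Require Import finmap generic_quotient ring_quotient monalg.
From mathcomp Require Import interval_inference mathcomp_extra boolp.
From mathcomp Require Import classical_sets reals topology convex tvs.

Set Implicit Arguments.
Unset Strict Implicit.
Unset Printing Implicit Defensive.

Import Order.TTheory GRing.Theory Num.Theory.
Import numFieldTopology.Exports.

Local Open Scope classical_set_scope.
Local Open Scope ring_scope.

(* [ncpoly R I] is R<x_i : i in I>, the monoid algebra of the free monoid on I.
   Its product and scaling are those of [{malg R[{fmonom I}]}], locked because
   comparing them by unfolding makes unification intractable. *)
HB.lock Definition ncmon (R : comNzRingType) (I : choiceType)
  (c : R) (m : {fmonom I}) : {malg R[{fmonom I}]} := << c *g m >>.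

HB.lock Definition ncmul (R : comNzRingType) (I : choiceType)
  (p q : {malg R[{fmonom I}]}) : {malg R[{fmonom I}]} := p * q.

HB.lock Definition ncscale (R : comNzRingType) (I : choiceType)
  (c : R) (p : {malg R[{fmonom I}]}) : {malg R[{fmonom I}]} := c *: p.

Section FreeAlgebra.
Context (R : comNzRingType) (I : choiceType).

Definition ncpoly : predArgType := {malg R[{fmonom I}]}.

HB.instance Definition _ := GRing.Zmodule.copy ncpoly {malg R[{fmonom I}]}.

Fact ncmulA : associative (@ncmul R I).
Proof. by rewrite ncmul.unlock; exact: mulrA. Qed.
Fact ncmul1 : left_id (ncmon 1 mone) (@ncmul R I).
Proof. by rewrite ncmon.unlock ncmul.unlock; exact: mul1r. Qed.
Fact ncmulr1 : right_id (ncmon 1 mone) (@ncmul R I).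
Proof. by rewrite ncmon.unlock ncmul.unlock; exact: mulr1. Qed.
Fact ncmulDl : left_distributive (@ncmul R I) +%R.
Proof. by rewrite ncmul.unlock; exact: mulrDl. Qed.
Fact ncmulDr : right_distributive (@ncmul R I) +%R.
Proof. by rewrite ncmul.unlock; exact: mulrDr. Qed.
Fact ncone_neq0 : ncmon 1 mone != 0 :> {malg R[{fmonom I}]}.
Proof. rewrite ncmon.unlock; exact: oner_neq0. Qed.

HB.instance Definition _ := GRing.Zmodule_isNzRing.Build ncpoly
  ncmulA ncmul1 ncmulr1 ncmulDl ncmulDr ncone_neq0.

Fact ncscaleA (a b : R) (p : ncpoly) : ncscale a (ncscale b p) = ncscale (a * b) p.
Proof. by rewrite ncscale.unlock; exact: scalerA. Qed.
Fact ncscale1 : left_id 1 (@ncscale R I).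
Proof. by rewrite ncscale.unlock; exact: scale1r. Qed.
Fact ncscaleDr : right_distributive (@ncscale R I) +%R.
Proof. by rewrite ncscale.unlock; exact: scalerDr. Qed.
Fact ncscaleDl (p : ncpoly) : {morph (@ncscale R I)^~ p : a b / a + b}.
Proof. by rewrite ncscale.unlock => a b; exact: scalerDl. Qed.

HB.instance Definition _ := GRing.Zmodule_isLmodule.Build R ncpoly
  ncscaleA ncscale1 ncscaleDr ncscaleDl.

Fact ncscaleAl (c : R) (p q : ncpoly) : c *: (p * q) = (c *: p) * q.
Proof.
rewrite -[LHS]/(ncscale c (ncmul p q)) -[RHS]/(ncmul (ncscale c p) q).
by rewrite ncscale.unlock ncmul.unlock scalerAl.
Qed.

HB.instance Definition _ := GRing.Lmodule_isLalgebra.Build R ncpoly ncscaleAl.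

Definition ncX (i : I) : ncpoly := ncmon 1 (fmu i).

Implicit Types (p q : ncpoly) (m : {fmonom I}).

Lemma ncpolyE p : p = \sum_(m <- msupp p) ncmon p@_m m.
Proof. rewrite ncmon.unlock; exact: monalgE. Qed.

Lemma ncpoly_mulU (a b : R) m1 m2 :
  (ncmon a m1 : ncpoly) * ncmon b m2 = ncmon (a * b) (mmul m1 m2).
Proof. by rewrite -[LHS]/(ncmul _ _) ncmul.unlock ncmon.unlock; exact: fgmulUU. Qed.

Lemma ncpoly_scaleU (a b : R) m : a *: (ncmon b m : ncpoly) = ncmon (a * b) m.
Proof.
rewrite -[LHS]/(ncscale _ _) ncscale.unlock ncmon.unlock.
by apply/malgP => k; rewrite mcoeffZ !mcoeffU mulrnAr.
Qed.

Lemma ncpoly_ind (P : ncpoly -> Prop) :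
  P 0 -> (forall p q, P p -> P q -> P (p + q)) ->
  (forall a m, P (ncmon a m)) -> forall p, P p.
Proof.
by move=> P0 PD PU p; rewrite [p]ncpolyE; apply: big_ind.
Qed.

Fact ncpoly_scalerAr (c : R) p q : c *: (p * q) = p * (c *: q).
Proof.
elim/ncpoly_ind: p => [|p p' IH IH'|a m]; first by rewrite !mul0r scaler0.
  by rewrite !mulrDl scalerDr IH IH'.
elim/ncpoly_ind: q => [|q q' IH IH'|b m']; first by rewrite mulr0 scaler0 mulr0.
  by rewrite scalerDr !mulrDr scalerDr IH IH'.
by rewrite ncpoly_scaleU !ncpoly_mulU ncpoly_scaleU mulrCA.
Qed.

HB.instance Definition _ := GRing.Lalgebra_isAlgebra.Build R ncpoly ncpoly_scalerAr.

End FreeAlgebra.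

Arguments ncX {R I} i.

(* Reverses every word; [ncstarM], [ncstarX] and linearity characterize it. *)
HB.lock Definition ncstar (R : comNzRingType) (I : choiceType)
  (p : ncpoly R I) : ncpoly R I :=
  \sum_(m <- msupp p) ncmon p@_m (FMonom (rev m)).

(* The unital algebra morphism sending the i-th variable to [b i]. *)
HB.lock Definition nceval (R : comNzRingType) (I : choiceType)
  (B : algType R) (b : I -> B) (p : ncpoly R I) : B :=
  \sum_(m <- msupp p) p@_m *: \prod_(i <- (m : seq I)) b i.

Section FreeAlgebraTheory.
Context {R : comNzRingType} {I : choiceType}.
Local Notation F := (ncpoly R I).
Implicit Types (p q : F) (m : {fmonom I}).

Lemma ncstarE p : ncstar p =
  mmap (@malgC {fmonom I} R) (fun m => ncmon 1 (FMonom (rev m))) p.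
Proof.
by rewrite ncstar.unlock ncmon.unlock; apply: eq_bigr => m _; rewrite [RHS]fgmulUU mulr1 mul1m.
Qed.

Lemma ncstarU (a : R) m : ncstar (ncmon a m) = ncmon a (FMonom (rev m)).
Proof. by rewrite ncstarE ncmon.unlock mmapU [LHS]fgmulUU mulr1 mul1m. Qed.

Fact ncstar_additive : additive (@ncstar R I).
Proof. by move=> p q; rewrite !ncstarE raddfB. Qed.

HB.instance Definition _ := GRing.isAdditive.Build F F (@ncstar R I) ncstar_additive.

Lemma ncstarD p q : ncstar (p + q) = ncstar p + ncstar q.
Proof. exact: raddfD. Qed.

Lemma ncstar0 : ncstar (0 : F) = 0.
Proof. exact: raddf0. Qed.

Fact ncstar_scalable : scalable (@ncstar R I).
Proof.
move=> c p; elim/ncpoly_ind: p => [|p q IH IH'|a m].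
- by rewrite scaler0 ncstar0 scaler0.
- by rewrite scalerDr !ncstarD /= IH IH' scalerDr.
- by rewrite ncpoly_scaleU !ncstarU ncpoly_scaleU.
Qed.

HB.instance Definition _ := GRing.isScalable.Build R F F *:%R (@ncstar R I) ncstar_scalable.

Lemma ncstarK : involutive (@ncstar R I).
Proof.
elim/ncpoly_ind => [|p q IH IH'|a m]; first by rewrite !ncstar0.
  by rewrite !ncstarD /= IH IH'.
by rewrite !ncstarU /= revK fmK.
Qed.

Lemma ncstarM p q : ncstar (p * q) = ncstar q * ncstar p.
Proof.
elim/ncpoly_ind: p => [|p p' IH IH'|a m]; first by rewrite mul0r ncstar0 mulr0.
  by rewrite mulrDl !ncstarD /= IH IH' mulrDr.
elim/ncpoly_ind: q => [|q q' IH IH'|b m']; first by rewrite mulr0 ncstar0 mul0r.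
  by rewrite mulrDr !ncstarD /= IH IH' mulrDl.
rewrite ncpoly_mulU !ncstarU ncpoly_mulU mulrC; congr ncmon.
by apply: val_inj; rewrite /= !fmM /= rev_cat.
Qed.

Lemma ncstarX i : ncstar (ncX i) = ncX i :> F.
Proof. by rewrite ncstarU; congr ncmon; apply: val_inj; rewrite /= fmU. Qed.

Lemma ncstar1 : ncstar (1 : F) = 1.
Proof. by rewrite [LHS]ncstarU; congr ncmon; apply: val_inj; rewrite /= fm1. Qed.

Section Eval.
Context (B : algType R) (b : I -> B).

Let h m : B := \prod_(i <- (m : seq I)) b i.

Lemma ncevalE p : nceval b p = mmap (in_alg B) h p.
Proof. by rewrite nceval.unlock; apply: eq_bigr => m _; rewrite mulr_algl. Qed.

Lemma ncevalU (a : R) m : nceval b (ncmon a m) = a *: h m.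
Proof. by rewrite ncevalE ncmon.unlock mmapU mulr_algl. Qed.

Fact nceval_additive : additive (@nceval R I B b).
Proof. by move=> p q; rewrite !ncevalE raddfB. Qed.

HB.instance Definition _ := GRing.isAdditive.Build F B (@nceval R I B b) nceval_additive.

Let ncevalD p q : nceval b (p + q) = nceval b p + nceval b q.
Proof. exact: raddfD. Qed.

Fact nceval_scalable : scalable (@nceval R I B b).
Proof.
move=> c p; elim/ncpoly_ind: p => [|p q IH IH'|a m].
- by rewrite scaler0 raddf0 scaler0.
- by rewrite scalerDr !ncevalD /= IH IH' scalerDr.
- by rewrite ncpoly_scaleU !ncevalU scalerA.
Qed.

HB.instance Definition _ :=
  GRing.isScalable.Build R F B *:%R (@nceval R I B b) nceval_scalable.

Fact nceval_multiplicative : multiplicative (@nceval R I B b).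
Proof.
split=> [p q|]; last by rewrite [LHS]ncevalU scale1r /h fm1 big_nil.
elim/ncpoly_ind: p => [|p p' IH IH'|a m]; first by rewrite mul0r raddf0 mul0r.
  by rewrite mulrDl !ncevalD /= IH IH' mulrDl.
elim/ncpoly_ind: q => [|q q' IH IH'|c m']; first by rewrite mulr0 raddf0 mulr0.
  by rewrite mulrDr !ncevalD /= IH IH' mulrDr.
rewrite ncpoly_mulU !ncevalU -scalerAl -scalerAr scalerA; congr (_ *: _).
by rewrite /h fmM big_cat.
Qed.

HB.instance Definition _ :=
  GRing.isMultiplicative.Build F B (@nceval R I B b) nceval_multiplicative.

Lemma ncevalX i : nceval b (ncX i : F) = b i.
Proof. by rewrite ncevalU scale1r /h fmU big_seq1. Qed.

Lemma nceval_unique (f : {lrmorphism F -> B}) :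
  (forall i, f (ncX i) = b i) -> f =1 nceval b.
Proof.
move=> fX; elim/ncpoly_ind => [|p q IH IH'|a m]; first by rewrite !raddf0.
  by rewrite !raddfD /= IH IH'.
rewrite -[a]mulr1 -ncpoly_scaleU linearZ [in RHS]linearZ /=; congr (_ *: _).
case: m => s; elim: s => [|i s IH].
  have -> : ncmon 1 (FMonom [::]) = 1 :> F by congr ncmon; apply: val_inj; rewrite /= fm1.
  by rewrite !rmorph1.
have -> : ncmon 1 (FMonom (i :: s)) = ncX i * ncmon 1 (FMonom s) :> F.
  rewrite ncpoly_mulU mulr1; congr ncmon; apply: val_inj.
  by rewrite /= fmM fmU.
by rewrite !rmorphM /= IH fX ncevalX.
Qed.

End Eval.
End FreeAlgebraTheory.

(* The free product of n copies of R[t, (1 + t^2)^-1], presented by generators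
   and relations: the quotient of the free algebra on x_j, y_j by the two-sided
   ideal expressing that y_j is a two-sided inverse of 1 + x_j^2. A morphism out
   of R[t, (1 + t^2)^-1] is an element b with 1 + b^2 invertible, so that
   [ratalg_universal] is the universal property of the free product. *)
Section RationalAlgebra.
Context (R : comNzRingType) (n : nat).

(* The letter [inl j] is x_j and [inr j] is y_j. *)
Let F : algType R := ncpoly R ('I_n + 'I_n)%type.
Let x (j : 'I_n) : F := ncX (inl j).
Let y (j : 'I_n) : F := ncX (inr j).

Definition ratrel (k : 'I_n * bool) : F :=
  let: (j, l) := k in
  if l then (1 + x j ^+ 2) * y j - 1 else y j * (1 + x j ^+ 2) - 1.

Definition ratideal : {pred F} := fun p =>
  `[< exists s : seq (F * ('I_n * bool) * F),
        p = \sum_(t <- s) t.1.1 * ratrel t.1.2 * t.2 >].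

Fact ratideal_zmod_closed : zmod_closed ratideal.
Proof.
split=> [|p q /asboolP[s ->] /asboolP[t ->]]; apply/asboolP.
  by exists [::]; rewrite big_nil.
exists (s ++ [seq (- u.1.1, u.1.2, u.2) | u <- t]).
rewrite big_cat big_map -sumrN; congr (_ + _); apply: eq_bigr => u _ /=.
by rewrite !mulNr.
Qed.

HB.instance Definition _ := GRing.isZmodClosed.Build F ratideal ratideal_zmod_closed.

Fact ratidealMl p q : q \in ratideal -> p * q \in ratideal.
Proof.
move=> /asboolP[s ->]; apply/asboolP; exists [seq (p * u.1.1, u.1.2, u.2) | u <- s].
by rewrite big_map mulr_sumr; apply: eq_bigr => u _; rewrite !mulrA.
Qed.

Fact ratidealMr p q : q \in ratideal -> q * p \in ratideal.
Proof.
move=> /asboolP[s ->]; apply/asboolP; exists [seq (u.1.1, u.1.2, u.2 * p) | u <- s].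
by rewrite big_map mulr_suml; apply: eq_bigr => u _; rewrite !mulrA.
Qed.

Fact ratidealZ (c : R) p : p \in ratideal -> c *: p \in ratideal.
Proof. by move=> Ip; rewrite -mulr_algl; exact: ratidealMl. Qed.

Fact ratidealP (B : algType R) (f : {rmorphism F -> B}) :
  (forall k, f (ratrel k) = 0) -> forall p, p \in ratideal -> f p = 0.
Proof.
move=> fr p /asboolP[s ->]; rewrite rmorph_sum big1 // => u _.
by rewrite !rmorphM /= fr mulr0 mul0r.
Qed.

Fact ratideal_star p : p \in ratideal -> ncstar p \in ratideal.
Proof.
move=> /asboolP[s ->]; apply/asboolP.
exists [seq (ncstar u.2, (u.1.2.1, ~~ u.1.2.2), ncstar u.1.1) | u <- s].
rewrite big_map raddf_sum; apply: eq_bigr => -[[a [j l]] b] _ /=.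
rewrite !ncstarM -mulrA; congr (_ * (_ * _)).
by case: l; rewrite /= expr2 raddfB /= ncstarM ncstarD ncstarM !ncstarX !ncstar1.
Qed.

Definition ratalg : Type := Quotient.quot ratideal.
HB.instance Definition _ := GRing.Zmodule.on ratalg.
HB.instance Definition _ := EqQuotient.on ratalg.

Let pi : F -> ratalg := \pi_ratalg%qT.

Fact ratalg_piP p q : pi p = pi q <-> p - q \in ratideal.
Proof. by split=> [/eqP|h]; [|apply/eqP; move: h]; rewrite Quotient.idealrBE. Qed.

Fact ratalg_reprK (a : ratalg) : pi (repr a) = a.
Proof. exact: reprK. Qed.

Fact ratalg_repr p : repr (pi p) - p \in ratideal.
Proof. by apply/ratalg_piP; rewrite ratalg_reprK. Qed.

Fact ratalg_piD p q : pi (p + q) = pi p + pi q.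
Proof. exact: (@Quotient.pi_add F ratideal). Qed.

Fact ratalg_piB p q : pi (p - q) = pi p - pi q.
Proof. by apply/eqP; rewrite eq_sym subr_eq -ratalg_piD subrK. Qed.

Definition ratalg_one : ratalg := pi 1.
Definition ratalg_mul (a b : ratalg) : ratalg := pi (repr a * repr b).
Definition ratalg_scale (c : R) (a : ratalg) : ratalg := pi (c *: repr a).

Fact ratalg_piM p q : pi (p * q) = ratalg_mul (pi p) (pi q).
Proof.
apply/esym/ratalg_piP.
have -> : repr (pi p) * repr (pi q) - p * q =
    (repr (pi p) - p) * repr (pi q) + p * (repr (pi q) - q).
  by rewrite mulrBl mulrBr addrA subrK.
by apply: rpredD; [apply: ratidealMr|apply: ratidealMl]; exact: ratalg_repr.
Qed.

Fact ratalg_piZ c p : pi (c *: p) = ratalg_scale c (pi p).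
Proof. by apply/esym/ratalg_piP; rewrite -scalerBr ratidealZ ?ratalg_repr. Qed.

Fact ratalg_mulA : associative ratalg_mul.
Proof.
move=> a b c; rewrite -[a]ratalg_reprK -[b]ratalg_reprK -[c]ratalg_reprK.
by rewrite -!ratalg_piM mulrA.
Qed.

Fact ratalg_mul1 : left_id ratalg_one ratalg_mul.
Proof. by move=> a; rewrite -[a]ratalg_reprK -ratalg_piM mul1r. Qed.

Fact ratalg_mulr1 : right_id ratalg_one ratalg_mul.
Proof. by move=> a; rewrite -[a]ratalg_reprK -ratalg_piM mulr1. Qed.

Fact ratalg_mulDl : left_distributive ratalg_mul +%R.
Proof.
move=> a b c; rewrite -[a]ratalg_reprK -[b]ratalg_reprK -[c]ratalg_reprK.
by rewrite -!(ratalg_piM, ratalg_piD) mulrDl.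
Qed.

Fact ratalg_mulDr : right_distributive ratalg_mul +%R.
Proof.
move=> a b c; rewrite -[a]ratalg_reprK -[b]ratalg_reprK -[c]ratalg_reprK.
by rewrite -!(ratalg_piM, ratalg_piD) mulrDr.
Qed.

(* Evaluate at x_j = 0, (1 + x_j ^ 2)^-1 = 1. *)
Fact ratalg_one_neq0 : ratalg_one != 0.
Proof.
have p0 : pi 0 = 0 by have := ratalg_piB 0 0; rewrite !subrr.
rewrite -p0; apply/negP => /eqP/ratalg_piP; rewrite subr0 => I1.
pose e (k : 'I_n + 'I_n) : R^o := if k is inl _ then 0 else 1.
suff: nceval e 1 = 0 by move/eqP; rewrite rmorph1 oner_eq0.
apply: (ratidealP _ I1) => -[j l].
by case: l; rewrite /= rmorphB rmorphM rmorphD rmorphXn /= !ncevalX /= rmorph1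
  expr2 mul0r addr0 mul1r subrr.
Qed.

HB.instance Definition _ := GRing.Zmodule_isNzRing.Build ratalg
  ratalg_mulA ratalg_mul1 ratalg_mulr1 ratalg_mulDl ratalg_mulDr ratalg_one_neq0.

Fact ratalg_scaleA a b v :
  ratalg_scale a (ratalg_scale b v) = ratalg_scale (a * b) v.
Proof. by rewrite -[v]ratalg_reprK -!ratalg_piZ scalerA. Qed.

Fact ratalg_scale1 : left_id 1 ratalg_scale.
Proof. by move=> a; rewrite -[a]ratalg_reprK -ratalg_piZ scale1r. Qed.

Fact ratalg_scaleDr : right_distributive ratalg_scale +%R.
Proof.
move=> c a b; rewrite -[a]ratalg_reprK -[b]ratalg_reprK.
by rewrite -!(ratalg_piZ, ratalg_piD) scalerDr.
Qed.

Fact ratalg_scaleDl v : {morph ratalg_scale^~ v : a b / a + b}.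
Proof.
by move=> a b; rewrite -[v]ratalg_reprK -!(ratalg_piZ, ratalg_piD) scalerDl.
Qed.

HB.instance Definition _ := GRing.Zmodule_isLmodule.Build R ratalg
  ratalg_scaleA ratalg_scale1 ratalg_scaleDr ratalg_scaleDl.

Fact ratalg_scaleAl (c : R) (a b : ratalg) : c *: (a * b) = (c *: a) * b.
Proof.
rewrite -[a]ratalg_reprK -[b]ratalg_reprK.
by rewrite -[RHS]/(ratalg_mul (ratalg_scale _ _) _) -[LHS]/(ratalg_scale _ (ratalg_mul _ _))
  -!(ratalg_piM, ratalg_piZ) scalerAl.
Qed.

HB.instance Definition _ := GRing.Lmodule_isLalgebra.Build R ratalg ratalg_scaleAl.

Fact ratalg_scaleAr (c : R) (a b : ratalg) : c *: (a * b) = a * (c *: b).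
Proof.
rewrite -[a]ratalg_reprK -[b]ratalg_reprK.
by rewrite -[RHS]/(ratalg_mul _ (ratalg_scale _ _)) -[LHS]/(ratalg_scale _ (ratalg_mul _ _))
  -!(ratalg_piM, ratalg_piZ) scalerAr.
Qed.

HB.instance Definition _ := GRing.Lalgebra_isAlgebra.Build R ratalg ratalg_scaleAr.

Definition ratpi : F -> ratalg := pi.

Fact ratpi_additive : additive ratpi.
Proof. exact: ratalg_piB. Qed.
HB.instance Definition _ := GRing.isAdditive.Build F ratalg ratpi ratpi_additive.

Fact ratpi_multiplicative : multiplicative ratpi.
Proof. by split=> // p q; rewrite /ratpi ratalg_piM. Qed.
HB.instance Definition _ := GRing.isMultiplicative.Build F ratalg ratpi ratpi_multiplicative.

Fact ratpi_scalable : scalable ratpi.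
Proof. exact: ratalg_piZ. Qed.
HB.instance Definition _ := GRing.isScalable.Build R F ratalg *:%R ratpi ratpi_scalable.

Definition ratX (j : 'I_n) : ratalg := ratpi (x j).

Definition ratstar (a : ratalg) : ratalg := ratpi (ncstar (repr a)).

Lemma ratpi_star p : ratstar (ratpi p) = ratpi (ncstar p).
Proof. by apply/ratalg_piP; rewrite -raddfB ratideal_star ?ratalg_repr. Qed.

End RationalAlgebra.

Section RationalAlgebraTheory.
Context {R : comNzRingType} {n : nat}.
Local Notation A := (ratalg R n).
Implicit Types a b : A.

Lemma ratpi_surj a : exists p, a = ratpi p.
Proof. by exists (repr a); rewrite [RHS]ratalg_reprK. Qed.

Lemma ratstarK : involutive (@ratstar R n).
Proof. by move=> a; have [p ->] := ratpi_surj a; rewrite !ratpi_star ncstarK. Qed.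

Lemma ratstarD a b : ratstar (a + b) = ratstar a + ratstar b.
Proof.
have [p ->] := ratpi_surj a; have [q ->] := ratpi_surj b.
by rewrite -rmorphD !ratpi_star ncstarD rmorphD.
Qed.

Lemma ratstarZ (c : R) a : ratstar (c *: a) = c *: ratstar a.
Proof.
have [p ->] := ratpi_surj a.
by rewrite -[c *: ratpi p]linearZ !ratpi_star [ncstar (_ *: _)]linearZ linearZ.
Qed.

Lemma ratstarM a b : ratstar (a * b) = ratstar b * ratstar a.
Proof.
have [p ->] := ratpi_surj a; have [q ->] := ratpi_surj b.
by rewrite -rmorphM !ratpi_star ncstarM rmorphM.
Qed.

Lemma ratstarX j : ratstar (ratX R j) = ratX R j :> A.
Proof. by rewrite ratpi_star ncstarX. Qed.

Lemma ratX_invr j : (1 + ratX R j ^+ 2) * ratpi (ncX (inr j)) = 1 :> A /\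
  ratpi (ncX (inr j)) * (1 + ratX R j ^+ 2) = 1 :> A.
Proof.
have e (k : 'I_n * bool) : ratpi (ratrel R k) = 0.
  rewrite -(rmorph0 (@ratpi R n)); apply/ratalg_piP; rewrite subr0; apply/asboolP.
  by exists [:: (1, k, 1)]; rewrite big_seq1 mul1r mulr1.
split; apply/eqP; rewrite -subr_eq0.
  by rewrite -(e (j, true)) /= rmorphB rmorphM rmorphD rmorphXn /= rmorph1.
by rewrite -(e (j, false)) /= rmorphB rmorphM rmorphD rmorphXn /= rmorph1.
Qed.

Lemma ratalg_universal (B : algType R) (b : 'I_n -> B) :
  (forall j, exists c, (1 + b j ^+ 2) * c = 1 /\ c * (1 + b j ^+ 2) = 1) ->
  exists2 f : {lrmorphism A -> B}, forall j, f (ratX R j) = b j &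
    forall g : {lrmorphism A -> B}, (forall j, g (ratX R j) = b j) -> g =1 f.
Proof.
move=> /choice[c bc].
pose e (k : 'I_n + 'I_n) : B := match k with inl j => b j | inr j => c j end.
have ker p q : ratpi p = ratpi q -> nceval e p = nceval e q.
  move=> /ratalg_piP pq; apply/eqP; rewrite -subr_eq0 -rmorphB; apply/eqP.
  apply: ratidealP pq => -[j l]; have [bc1 bc2] := bc j.
  by case: l; rewrite /= rmorphB rmorphM rmorphD rmorphXn /= !ncevalX rmorph1 /=
    ?bc1 ?bc2 subrr.
pose f a := nceval e (repr a).
have fpi p : f (ratpi p) = nceval e p by apply: ker; exact: ratalg_reprK.
have fB : additive f.
  move=> a a'; have [p ->] := ratpi_surj a; have [q ->] := ratpi_surj a'.
  by rewrite -rmorphB !fpi rmorphB.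
have fM : multiplicative f.
  split=> [a a'|]; last by rewrite -(rmorph1 (@ratpi R n)) fpi rmorph1.
  have [p ->] := ratpi_surj a; have [q ->] := ratpi_surj a'.
  by rewrite -rmorphM !fpi rmorphM.
have fZ : scalable f.
  move=> k a; have [p ->] := ratpi_surj a.
  by rewrite -[k *: ratpi p]linearZ !fpi linearZ.
pose fa := GRing.isAdditive.Build A B f fB.
pose fm := GRing.isMultiplicative.Build A B f fM.
pose fs := GRing.isScalable.Build R A B *:%R f fZ.
pose phi : {lrmorphism A -> B} := HB.pack f fa fm fs.
exists phi => [j|g gX a]; first by rewrite -[LHS]/(f (ratpi _)) fpi ncevalX.
have [p ->] := ratpi_surj a; rewrite -[RHS]/(f (ratpi _)) fpi.
apply: (@nceval_unique R _ B e (g \o @ratpi R n)) => -[j|j] /=; first exact: gX.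
have [bc1 bc2] := bc j; have := ratX_invr j => -[xy1 xy2].
rewrite -[LHS]mulr1 -bc1 mulrA -gX.
have -> : 1 + g (ratX R j) ^+ 2 = g (1 + ratX R j ^+ 2) by rewrite rmorphD rmorph1 rmorphXn.
by rewrite -rmorphM xy2 rmorph1 mul1r.
Qed.

End RationalAlgebraTheory.

Section EmbeddingDef.
Context (R : comNzRingType) (n : nat).
Local Notation F := (ncpoly R 'I_n).
Local Notation A := (ratalg R n).

Definition ratembed : F -> A := nceval (@ratX R n).

HB.instance Definition _ := GRing.LRMorphism.copy ratembed (nceval (@ratX R n)).

Lemma ratembed_star p : ratembed (ncstar p) = ratstar (ratembed p).
Proof.
have s0 : ratstar (0 : A) = 0 by rewrite -(scale0r (0 : A)) ratstarZ !scale0r.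
have s1 : ratstar (1 : A) = 1.
  by rewrite -[1](rmorph1 (@ratpi R n)) ratpi_star ncstar1.
elim/ncpoly_ind: p => [|p q IH IH'|c m]; first by rewrite ncstar0 rmorph0 s0.
  by rewrite ncstarD !rmorphD /= IH IH' ratstarD.
rewrite ncstarU /ratembed !ncevalU ratstarZ; congr (_ *: _) => /=.
case: m => s /=; elim: s => [|j s IH]; first by rewrite /rev /= !big_nil s1.
by rewrite rev_cons -cats1 big_cat big_seq1 big_cons IH ratstarM ratstarX.
Qed.

End EmbeddingDef.

(* Injectivity is checked on a truncated Fock representation: [e s] is the basis
   vector of the word s, and [X j] appends the letter j to it. *)
Section Embedding.
Context {R : comNzRingType} {n : nat}.
Implicit Types (s t : seq 'I_n) (j : 'I_n).

Section Fock.
Variable N : nat.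

Let e s : 'rV[R]_N.+1 := \row_v (v == choice.pickle s :> nat)%:R.
Let X j : 'M[R]_N.+1 := \matrix_(u, v)
  (if @choice.pickle_inv (seq 'I_n) u is Some s then (v == choice.pickle (rcons s j) :> nat)%:R else 0).

Let e0 s : (N < choice.pickle s)%N -> e s = 0.
Proof.
move=> Ns; apply/rowP => v; rewrite !mxE; case: eqP => // vs.
by have := ltn_ord v; rewrite vs ltnS leqNgt Ns.
Qed.

Let eX s j : e s *m X j = (choice.pickle s <= N)%N%:R *: e (rcons s j).
Proof.
case: (leqP (choice.pickle s) N) => Ns; last by rewrite e0 // mul0mx scale0r.
rewrite scale1r; apply/rowP => v; rewrite !mxE.
rewrite (bigD1 (Ordinal (Ns : (_ < N.+1)%N))) //= !mxE eqxx mul1r pickleK_inv.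
rewrite big1 ?addr0 // => u; rewrite -val_eqE /= => /negbTE us.
by rewrite !mxE us mul0r.
Qed.

Let eXs s t : exists2 c : bool,
  e s *m \prod_(i <- t) X i = c%:R *: e (s ++ t) &
  (forall k, choice.pickle (take k (s ++ t)) <= N)%N -> c.
Proof.
elim: t s => [|j t IH] s.
  by exists true; rewrite // big_nil mulmx1 cats0 scale1r.
have [c ec hc] := IH (rcons s j).
exists ((choice.pickle s <= N)%N && c).
  rewrite big_cons -mulmxE mulmxA eX -scalemxAl ec cat_rcons scalerA.
  by rewrite -natrM mulnb.
move=> h; apply/andP; split; last by apply: hc; rewrite cat_rcons.
by have := h (size s); rewrite take_size_cat.
Qed.

Let X_nilpotent j : exists k, X j ^+ k = 0.
Proof.
pose K := \max_(u < N.+1) size (odflt [::] (@choice.pickle_inv (seq 'I_n) u)).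
have sK s : (choice.pickle s <= N)%N -> (size s <= K)%N.
  move=> Ns; have := @leq_bigmax _ (fun u : 'I_N.+1 =>
    size (odflt [::] (@choice.pickle_inv (seq 'I_n) u))) (Ordinal (Ns : (_ < N.+1)%N)).
  by rewrite /= pickleK_inv.
exists K.+1; apply/row_matrixP => u; rewrite row0 rowE.
case us: (@choice.pickle_inv (seq 'I_n) u) => [s|]; last first.
  have -> : delta_mx 0 u *m X j ^+ K.+1 = row u (X j) *m X j ^+ K.
    by rewrite exprS -mulmxE mulmxA -rowE.
  suff -> : row u (X j) = 0 by rewrite mul0mx.
  by apply/rowP => v; rewrite !mxE us.
have -> : delta_mx 0 u = e s.
  apply/rowP => v; rewrite !mxE eqxx /=; congr (nat_of_bool _)%:R.
  by have := @choice.pickle_invK (seq 'I_n) u; rewrite us /= => ->.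
have [c + _] := eXs s (nseq K.+1 j).
rewrite big_nseq iter_mulr_1 => ->.
rewrite e0 ?scaler0 // ltnNge; apply/negP => /sK.
by rewrite size_cat size_nseq addnS ltnNge leq_addl.
Qed.

Let X_inv j : exists c, (1 + X j ^+ 2) * c = 1 /\ c * (1 + X j ^+ 2) = 1.
Proof.
have [k Xk] := X_nilpotent j.
pose a := - X j ^+ 2.
have ak : a ^+ k = 0 by rewrite exprNn -exprM mulnC exprM Xk expr0n /= mulr0.
pose c := \sum_(i < k) a ^+ i.
have ac : GRing.comm a c by apply: commr_sum => i _; exact: commrX.
have e1 : (1 - a) * c = 1 by rewrite -opprB mulNr -subrX1 ak sub0r opprK.
exists c; rewrite -[X j ^+ 2]opprK -/a e1; split=> //.
by rewrite mulrBr -ac mulr1 -[X in X - _]mul1r -mulrBl.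
Qed.

Lemma fock_separates (p : ncpoly R 'I_n) (m : {fmonom 'I_n}) :
  (forall k, choice.pickle (take k (m : seq 'I_n)) <= N)%N ->
  ratembed p = 0 -> p@_m = 0.
Proof.
move=> mN p0.
have [f fX _] := ratalg_universal X_inv.
have: nceval X p = 0.
  rewrite -(@nceval_unique R _ _ X (f \o @ratembed R n)) /= ?p0 ?rmorph0 // => j.
  by rewrite /= /ratembed ncevalX fX.
rewrite nceval.unlock => /(congr1 (mulmx (e [::]))); rewrite mulmx0 mulmx_sumr.
have mN1 : (choice.pickle (m : seq 'I_n) < N.+1)%N by have := mN (size m); rewrite take_size.
move=> /rowP/(_ (Ordinal mN1)); rewrite summxE !mxE.
have term m' : (e [::] *m (p@_m' *: \prod_(i <- (m' : seq 'I_n)) X i)) 0 (Ordinal mN1)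
    = p@_m' *+ (m' == m).
  have [c ec hc] := eXs [::] m'.
  rewrite -scalemxAr ec !mxE /= (inj_eq (pcan_inj choice.pickleK)) eq_sym val_eqE.
  case: eqP => [mm|_]; last by rewrite !mulr0.
  by rewrite hc ?mulr1 // mm.
under eq_bigr do rewrite term.
have [ms|ms] := boolP (m \in msupp p); last by move: ms; rewrite -mcoeff_eq0 => /eqP.
rewrite (bigD1_seq m) ?fset_uniq //= eqxx big1 ?addr0 // => i /negbTE ->.
by rewrite mulr0n.
Qed.

End Fock.

Lemma ratembed_inj : injective (@ratembed R n).
Proof.
move=> p q pq; apply/eqP; rewrite -subr_eq0; apply/eqP/malgP => m.
pose N := \max_(k < (size m).+1) choice.pickle (take k (m : seq 'I_n)).
rewrite mcoeff0; apply: (@fock_separates N); last first.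
  by rewrite rmorphB /= pq subrr.
move=> k; case: (ltnP k (size m).+1) => km.
  exact: (leq_bigmax (Ordinal km)).
rewrite take_oversize; last exact: ltnW.
have := @leq_bigmax _ (fun k : 'I_(size m).+1 => choice.pickle (take k (m : seq 'I_n))) ord_max.
by rewrite /= take_size.
Qed.

End Embedding.

Section Cone.
Context (R : comNzRingType) (n : nat).
Local Notation F := (ncpoly R 'I_n).
Local Notation A := (ratalg R n).

Definition selfadjoint : {pred F} := fun p => ncstar p == p.

Fact selfadjoint_submod_closed : submod_closed selfadjoint.
Proof.
split=> [|c p q /eqP sp /eqP sq]; first by apply/eqP; rewrite ncstar0.
by apply/eqP; rewrite ncstarD [ncstar (_ *: _)]linearZ /= sp sq.
Qed.

HB.instance Definition _ :=
  GRing.isSubmodClosed.Build R F selfadjoint selfadjoint_submod_closed.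

Definition ncsa : predArgType := {p : F | p \in selfadjoint}.

HB.instance Definition _ := SubType.on ncsa.
HB.instance Definition _ := [Choice of ncsa by <:].
HB.instance Definition _ := [SubChoice_isSubLmodule of ncsa by <:].

Definition sum_of_squares : set A :=
  [set a | exists s : seq A, a = \sum_(b <- s) b * ratstar b].

Definition commutator_span : set A :=
  [set a | exists s : seq (R * A * A),
    a = \sum_(t <- s) t.1.1 *: (t.1.2 * t.2 - t.2 * t.1.2)].

(* R<x> is identified with its image in A by the injection [ratembed]. *)
Definition coneK : set ncsa :=
  [set p | exists a b, [/\ sum_of_squares a, commutator_span b &
                           ratembed (val p) = a + b]].

End Cone.

Arguments coneK R n : clear implicits.

(* An alias of V carrying its finest locally convex topology, whose neighborhoods
   of 0 are the supersets of convex balanced absorbing sets. That it is locally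
   convex is the [tvsType] instance below; that it is the finest such topology is
   [finest_lcP], applied to the identity of V. *)
Definition finest_lc (R : realType) (V : lmodType R) : Type := V.

HB.instance Definition _ (R : realType) (V : lmodType R) :=
  GRing.Lmodule.copy (finest_lc V) V.

Section FinestLocallyConvex.
Context {R : realType} {V : lmodType R}.
Implicit Types (W : set V) (p x : V).

Definition balanced W := forall (t : R) x, `|t| <= 1 -> W x -> W (t *: x).

Definition absorbing W := forall x, exists2 r : R, 0 < r & W (r *: x).

Definition flc_disk W := [/\ convex_set W, balanced W & absorbing W].

Definition flc_nbhs p : set_system V :=
  [set U | exists2 W, flc_disk W & forall w, W w -> U (p + w)].

Lemma convexP W : convex_set W <->
  forall (t : R) x y, 0 <= t -> t <= 1 -> W x -> W y -> W (t *: x + (1 - t) *: y).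
Proof.
split=> [cW t x y t0 t1 Wx Wy|cW x y l /set_mem Wx /set_mem Wy]; last first.
  by apply/mem_set; exact: cW.
exact/set_mem/(cW x y (Itv01 t0 t1) (mem_set Wx) (mem_set Wy)).
Qed.

Lemma flc_disk0 W : flc_disk W -> W 0.
Proof. by case=> _ _ /(_ 0) [r _]; rewrite scaler0. Qed.

Lemma flc_diskT : flc_disk setT.
Proof. by split=> [|//|x]; [apply/convexP|exists 1]. Qed.

Lemma absorbing_le W : balanced W -> absorbing W -> forall x,
  exists2 r : R, 0 < r & forall t, `|t| <= r -> W (t *: x).
Proof.
move=> bW aW x; have [r r0 Wr] := aW x; exists r => // t tr.
have -> : t *: x = (t / r) *: (r *: x) by rewrite scalerA divfK // gt_eqF.
by apply: bW => //; rewrite normrM normfV (gtr0_norm r0) ler_pdivrMr// mul1r.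
Qed.

Lemma flc_diskI W W' : flc_disk W -> flc_disk W' -> flc_disk (W `&` W').
Proof.
move=> [/convexP cW bW aW] [/convexP cW' bW' aW']; split.
- by apply/convexP => t x y t0 t1 [? ?] [? ?]; split; [apply: cW|apply: cW'].
- by move=> t x t1 [? ?]; split; [apply: bW|apply: bW'].
- move=> x; have [r r0 Wr] := absorbing_le bW aW x.
  have [s s0 Ws] := absorbing_le bW' aW' x.
  exists (Num.min r s); first by rewrite lt_min r0.
  by split; [apply: Wr|apply: Ws];
    rewrite ger0_norm ?le_min ?(ltW r0) ?(ltW s0) ?ge_min ?lexx ?orbT.
Qed.

Lemma flc_diskZ (r : R) W : 0 < r -> flc_disk W ->
  flc_disk [set x | W (r *: x)].
Proof.
move=> r0 [/convexP cW bW aW]; split.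
- apply/convexP => t x y t0 t1 /= Wx Wy.
  by rewrite scalerDr !scalerA ![r * _]mulrC -!scalerA; apply: cW.
- by move=> t x t1 /= Wx; rewrite scalerA mulrC -scalerA; apply: bW.
- by move=> x; have [s s0 Ws] := aW (r *: x); exists s; rewrite //= scalerA mulrC -scalerA.
Qed.

Lemma flc_halfD W x y : flc_disk W -> W (2%:R *: x) -> W (2%:R *: y) -> W (x + y).
Proof.
move=> [/convexP cW _ _] Wx Wy.
have -> : x + y = 2%:R^-1 *: (2%:R *: x) + (1 - 2%:R^-1) *: (2%:R *: y).
  have e : (1 - 2^-1 = 2^-1 :> R) by rewrite {1}(splitr 1) div1r addrK.
  by rewrite e !scalerA mulVf ?pnatr_eq0// !scale1r.
by apply: cW => //; rewrite ?invr_ge0 ?ler0n // invf_le1 ?ler1n ?ltr0n.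
Qed.

Fact flc_nbhs_filter p : ProperFilter (flc_nbhs p).
Proof.
split.
  by move=> [W dW /(_ _ (flc_disk0 dW))].
split.
- by exists setT; [exact: flc_diskT|].
- move=> U U' [W dW WU] [W' dW' WU'].
  by exists (W `&` W'); [exact: flc_diskI|move=> w [? ?]; split; auto].
- by move=> U U' UU' [W dW WU]; exists W => // w Ww; apply/UU'/WU.
Qed.

Fact flc_nbhs_singleton p (U : set V) : flc_nbhs p U -> U p.
Proof. by case=> W /flc_disk0 W0 /(_ _ W0); rewrite addr0. Qed.

Fact flc_nbhs_nbhs p (U : set V) : flc_nbhs p U -> flc_nbhs p (flc_nbhs^~ U).
Proof.
case=> W dW WU; have d2 := flc_diskZ (ltr0Sn R 1) dW.
exists [set x | W (2%:R *: x)] => // w /= Ww; exists [set x | W (2%:R *: x)] => //= w' Ww'.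
by rewrite -addrA; apply: WU; apply: flc_halfD.
Qed.

End FinestLocallyConvex.

HB.instance Definition _ (R : realType) (V : lmodType R) :=
  hasNbhs.Build (finest_lc V) (@flc_nbhs R V).
HB.instance Definition _ (R : realType) (V : lmodType R) :=
  Nbhs_isNbhsTopological.Build (finest_lc V)
    (@flc_nbhs_filter R V) (@flc_nbhs_singleton R V) (@flc_nbhs_nbhs R V).

Section FinestTvs.
Context {R : realType} {V : lmodType R}.
Local Notation E := (finest_lc V).

Lemma flc_nbhsP (p : E) (U : set E) :
  nbhs p U <-> exists2 W : set V, flc_disk W & forall w, W w -> U (p + w).
Proof. by []. Qed.

Fact flc_add_continuous : continuous (fun x : E * E => x.1 + x.2).
Proof.
move=> [p q] U /= [W dW WU]; have d2 := flc_diskZ (ltr0Sn R 1) dW.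
exists ([set p + w | w in [set x : V | W (2%:R *: x)]],
        [set q + w | w in [set x : V | W (2%:R *: x)]]) => /=.
  by split; exists [set x | W (2%:R *: x)] => // w Ww; exists w.
move=> [_ _] /= [[w Ww <-] [w' Ww' <-]].
by rewrite addrACA; apply: WU; apply: flc_halfD.
Qed.

Fact flc_scale_continuous : continuous (fun z : R^o * E => z.1 *: z.2).
Proof.
move=> [k p] U /= [W dW WU]; have [_ bW aW] := dW.
have [r r0 Wr] := absorbing_le bW aW (2%:R *: p : V).
pose c : R := 2%:R * (`|k| + r).
have c0 : 0 < c by rewrite mulr_gt0 ?ltr0n // ltr_wpDl.
exists ([set l : R^o | `|k - l| < r], [set p + w | w in [set x : V | W (c *: x)]]) => /=.
  split; first by exists r.
  by exists [set x | W (c *: x)]; [exact: flc_diskZ|move=> w Ww; exists w].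
move=> [l _] /= [kl [w Ww <-]].
have -> : l *: (p + w) = k *: p + ((l - k) *: p + l *: w).
  by rewrite addrA -scalerDl [k + _]addrC subrK scalerDr.
apply: WU; apply: flc_halfD => //.
  by rewrite scalerA mulrC -scalerA; apply: Wr; rewrite distrC ltW.
have -> : 2%:R *: (l *: w) = (2%:R * l / c) *: (c *: w : V).
  by rewrite !scalerA divfK // gt_eqF.
apply: bW Ww; rewrite normrM normfV (gtr0_norm c0) ler_pdivrMr// mul1r normrM.
rewrite ger0_norm ?ler0n // ler_pM2l ?ltr0n //.
rewrite -[l](addrNK k) addrC (le_trans (ler_normD _ _))// lerD2l distrC.
exact: ltW.
Qed.

Fact flc_locally_convex : exists2 B : set_system E,
  (forall b, b \in B -> convex_set b) & basis B.
Proof.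
exists [set b | convex_set b /\ open b]; first by move=> b /set_mem [].
split; first by move=> b [].
move=> p U [W dW WU].
pose b : set E := [set x | exists2 s : R, 0 < s < 1 & W (s^-1 *: (x - p))].
have [/convexP cW bW aW] := dW.
exists b; last first.
  move=> x [s /andP[s0 s1] Ws]; rewrite -[x](subrK p) addrC; apply: WU.
  have -> : x - p = s *: (s^-1 *: (x - p)) by rewrite scalerA mulfV ?scale1r ?gt_eqF.
  by apply: bW => //; rewrite ger0_norm ltW.
split; last first.
  exists 2%:R^-1; first by rewrite invr_gt0 ltr0n invf_lt1 ?ltr1n ?ltr0n.
  by rewrite subrr scaler0; exact: flc_disk0.
split.
  apply/convexP => t x y t0 t1 [s /andP[s0 s1] Ws] [u /andP[u0 u1] Wu].
  pose m := Num.max s u.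
  have mono (v : R) z : 0 < v -> v <= m -> W (v^-1 *: z) -> W (m^-1 *: z).
    move=> v0 vm Wv; have m0 := lt_le_trans v0 vm.
    have -> : m^-1 *: z = (v / m) *: (v^-1 *: z).
      by rewrite scalerA mulrAC mulfV ?mul1r// gt_eqF.
    apply: bW => //; rewrite ger0_norm; last by rewrite divr_ge0 // ltW.
    by rewrite ler_pdivrMr// mul1r.
  exists m; first by rewrite /m lt_max s0 gt_max s1.
  have -> : m^-1 *: (t *: x + (1 - t) *: y - p) =
      t *: (m^-1 *: (x - p)) + (1 - t) *: (m^-1 *: (y - p)).
    rewrite !scalerA ![_ * m^-1]mulrC -!scalerA -scalerDr; congr (_ *: _).
    rewrite !scalerBr addrACA -opprD -scalerDl.
    by rewrite [t + _]addrC subrK scale1r.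
  by apply: cW => //; [apply: (mono s)|apply: (mono u)] => //; rewrite le_max lexx ?orbT.
rewrite openE => x [s /andP[s0 s1] Ws]; rewrite /interior.
pose m := (s + 1) / 2%:R.
have [sm m1] : s < m /\ m < 1 by rewrite /m !midf_lt.
have m0 := lt_trans s0 sm.
pose c := (m - s)^-1.
have ms : 0 < m - s by rewrite subr_gt0.
exists [set w | W (c *: w)]; first by apply: flc_diskZ => //; rewrite invr_gt0.
move=> w /= Ww; exists m; first by rewrite m0.
have -> : m^-1 *: (x + w - p) =
    (s / m) *: (s^-1 *: (x - p)) + (1 - s / m) *: (c *: w).
  rewrite addrAC scalerDr; congr (_ + _).
    by rewrite scalerA mulrAC mulfV ?mul1r ?gt_eqF.
  rewrite scalerA -{1}[1](mulfV (lt0r_neq0 m0)) -mulrBl mulrAC mulfV ?mul1r//.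
  by rewrite gt_eqF.
by apply: cW => //; [rewrite divr_ge0 ?ltW|rewrite ler_pdivrMr// mul1r ltW].
Qed.

HB.instance Definition _ := PreTopologicalLmod_isTvs.Build R E
  flc_add_continuous flc_scale_continuous flc_locally_convex.

Lemma finest_lcP (F : tvsType R) (f : {linear V -> F}) :
  continuous (f : E -> F).
Proof.
move=> p U; have [B cB [oB Bnbhs]] := @locally_convex R F.
move=> fpU.
have : nbhs (0 : F) [set y | U (f p + y)].
  have := @add_continuous F (f p, 0) U; rewrite /= addr0 => /(_ fpU) [[A1 A2] /= [A1p A20] AU].
  apply: filterS A20 => y A2y; apply: (AU (f p, y)); split=> //=.
  exact: nbhs_singleton A1p.
move=> /Bnbhs [b [Bb b0] bU].
have /convexP cb := cB _ (mem_set Bb).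
pose W := [set x : V | b (f x) /\ b (- f x)].
exists W; last by move=> w [Ww _]; rewrite /= linearD; exact: bU.
have cW : convex_set W.
  apply/convexP => t x y t0 t1 [bx bx'] [by_ by_']; split.
    by rewrite linearD !linearZ; apply: cb.
  by rewrite linearD !linearZ opprD -!scalerN; apply: cb.
have sc (t : R) y : 0 <= t -> t <= 1 -> b y -> b (t *: y).
  move=> t0 t1 yb; have := cb t y 0 t0 t1 yb b0.
  by rewrite scaler0 addr0.
split=> //.
  move=> t x t1 [bx bx']; rewrite /W /=.
  have -> : - f (t *: x) = t *: - f x by rewrite linearZ scalerN.
  have -> : f (t *: x) = t *: f x by rewrite linearZ.
  have [t0|t0] := leP 0 t.
    by move: t1; rewrite ger0_norm// => t1; split; apply: sc.
  move: t1; rewrite ltr0_norm// => t1.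
  have e (y : F) : t *: y = (- t) *: (- y) by rewrite scaleNr scalerN opprK.
  by rewrite (e (f x)) (e (- f x)) opprK; split; apply: sc; rewrite // oppr_ge0 ltW.
move=> x.
have nb : nbhs (0 : F) b by move: (oB _ Bb); rewrite openE; apply.
have := @scale_continuous R F (0, f x) b; rewrite /= scale0r => /(_ nb).
move=> [[A1 A2] /= [[r /= r0 rA1] A2x] Ab].
have A2fx := nbhs_singleton A2x.
exists (r / 2%:R); first by rewrite divr_gt0 ?ltr0n.
have h (s : R) : `|s| = r / 2%:R -> A1 s.
  move=> sr; apply: rA1; rewrite /ball_ /= sub0r normrN sr.
  by rewrite ltr_pdivrMr ?ltr0n // ltr_pMr // ltr1n.
have r2 : 0 <= r / 2%:R by rewrite divr_ge0 ?ler0n // ltW.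
rewrite /W /= linearZ -scaleNr; split; apply: (Ab (_, f x)); split => //=; apply: h.
  by rewrite ger0_norm.
by rewrite normrN ger0_norm.
Qed.

End FinestTvs.

(* Main.v *)
Require Import Defs.
From mathcomp Require Import all_boot all_order all_algebra.
From mathcomp Require Import boolp classical_sets reals topology tvs.
From HB Require Import structures.
From mathcomp Require Import ssrAC monalg ring lra zify.

Import GRing.Theory.
Import Order.TTheory Num.Theory.

Set Implicit Arguments.
Unset Strict Implicit.
Unset Printing Implicit Defensive.

Local Open Scope classical_set_scope.
Local Open Scope ring_scope.

(* Write a, b, c for x_1, x_2, x_3.

   [h] is not in the cone: map A to the rational functions R(x, y, l) by
   a |-> l x, b |-> l y, c |-> l.  Commutators die, so h would become a sum of
   squares of fractions with denominators (1 + l^2 x^2)(1 + l^2 y^2)(1 + l^2).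
   Clearing them and comparing leading coefficients in l, which only multiplies
   by a power of (x y)^2, makes x^2N y^2N M(x, y, 1) a sum of squares of
   polynomials, M being the Motzkin form.  The extreme coefficients of
   the summands then force the coefficient -3 of x^2 y^2 to be a sum of squares.

   [h] is in the closure: let alpha and gamma be positive elements commuting with
   a and c respectively.  Modulo commutators, f b g b is a positive function of
   two commuting variables (f a function of c and g one of a), hence
     t (s - t)^2 (2 s + t) = 2 s^3 t + t^4 - 3 s^2 t^2 >= 0
   gives 3 gamma^2 b alpha^2 b <= 2 gamma^3 b alpha b + b alpha^4 b, while
     0 <= (gamma^3 - b alpha b)^2  and  (b alpha b)^2 <= b^2 alpha^2 b^2
   bound 2 gamma^3 b alpha b by gamma^6 + b^2 alpha^2 b^2.  With alpha = |a| and
   gamma = |c| the sum would be h >= 0; the algebra A only contains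
   approximations of |a| and |c| from above, and they prove h + e k >= 0 for a
   fixed k and every small e > 0. *)

(** * Sums of squares of polynomials and the Motzkin form *)

(** Stated for any nonzero ring, so that it can be passed up a tower of polynomial rings. *)
Definition formally_real (K : nzRingType) :=
  forall s : seq K, \sum_(a <- s) a ^+ 2 = 0 -> {in s, forall a, a = 0}.

Lemma coefM_low (K : nzRingType) (p q : {poly K}) i j :
  (forall k, (k < i)%N -> p`_k = 0) -> (forall k, (k < j)%N -> q`_k = 0) ->
  (p * q)`_(i + j) = p`_i * q`_j.
Proof.
move=> pi qj; rewrite coefM.
have ij : (i < (i + j).+1)%N by rewrite ltnS leq_addr.
rewrite (bigD1 (Ordinal ij)) //= addKn big1 ?addr0 // => k.
rewrite -val_eqE /= neq_ltn => /orP[/pi ->|ik]; first by rewrite mul0r.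
by rewrite qj ?mulr0 //; have := ltn_ord k; lia.
Qed.

Lemma coefM_top (K : nzRingType) (p q : {poly K}) i j :
  (size p <= i.+1)%N -> (size q <= j.+1)%N ->
  (p * q)`_(i + j) = p`_i * q`_j.
Proof.
move=> pi qj; rewrite coefM.
have ij : (i < (i + j).+1)%N by rewrite ltnS leq_addr.
rewrite (bigD1 (Ordinal ij)) //= addKn big1 ?addr0 // => k.
rewrite -val_eqE /= neq_ltn => /orP[ki|ik].
  by rewrite [q`__]nth_default ?mulr0 //; apply: leq_trans qj _; have := ltn_ord k; lia.
by rewrite nth_default ?mul0r //; apply: leq_trans pi _.
Qed.

Section SumsOfSquares.
Variables (K : nzRingType) (realK : formally_real K).
Implicit Types ps : seq {poly K}.

Lemma sum_sqr_eq0 (T : eqType) (F : T -> K) (s : seq T) :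
  \sum_(t <- s) F t ^+ 2 = 0 -> {in s, forall t, F t = 0}.
Proof.
rewrite -(big_map F xpredT (fun a => a ^+ 2)) => /realK h t ts.
by apply: h; apply: map_f.
Qed.

(** Once all summands have order at least [k], the coefficient of degree [2k] is the sum of the
    squares of theirs in degree [k]; if it vanishes, so do these, and the order goes up by one. *)
Lemma coef_sum_sqr_low ps m :
  (forall j, (j < m)%N -> (\sum_(p <- ps) p ^+ 2)`_(j + j) = 0) ->
  (forall p, p \in ps -> forall j, (j < m)%N -> p`_j = 0) /\
  (\sum_(p <- ps) p ^+ 2)`_(m + m) = \sum_(p <- ps) p`_m ^+ 2.
Proof.
have low k : (forall p, p \in ps -> forall j, (j < k)%N -> p`_j = 0) ->
    (\sum_(p <- ps) p ^+ 2)`_(k + k) = \sum_(p <- ps) p`_k ^+ 2.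
  move=> h; rewrite coef_sum; apply: eq_big_seq => p /h pk.
  by rewrite expr2 coefM_low.
elim: m => [_|m IH h]; first by split; [|exact: low].
have [hm e] := IH (fun j jm => h j (ltnW jm)).
suff hS : (forall p, p \in ps -> forall j, (j < m.+1)%N -> p`_j = 0) by split; [|exact: low].
move=> p pps j; rewrite ltnS leq_eqVlt => /orP[/eqP->|]; last exact: hm.
by apply: (sum_sqr_eq0 (F := fun p : {poly K} => p`_m)) pps; rewrite -e h.
Qed.

(** The mirror image of [coef_sum_sqr_low]: top coefficients cannot cancel in a sum of squares, so a
    common bound on the sizes descends to [m.+1]. *)
Lemma size_sum_sqr ps m :
  (forall j, (m < j)%N -> (\sum_(p <- ps) p ^+ 2)`_(j + j) = 0) ->
  (forall p : {poly K}, p \in ps -> (size p <= m.+1)%N) /\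
  (\sum_(p <- ps) p ^+ 2)`_(m + m) = \sum_(p <- ps) p`_m ^+ 2.
Proof.
move=> h.
have top k : (forall p : {poly K}, p \in ps -> (size p <= k.+1)%N) ->
    (\sum_(p <- ps) p ^+ 2)`_(k + k) = \sum_(p <- ps) p`_k ^+ 2.
  move=> hk; rewrite coef_sum; apply: eq_big_seq => p /hk pk.
  by rewrite expr2 coefM_top.
suff hm : (forall p : {poly K}, p \in ps -> (size p <= m.+1)%N) by split; [|exact: top].
have [e he] : exists e, (forall p : {poly K}, p \in ps -> (size p <= m.+1 + e)%N).
  exists (\max_(p <- ps) size p)%N => p pps.
  by rewrite (big_rem p) //=; lia.
elim: e he => [|e IH] he; first by move=> p /he; rewrite addn0.
apply: IH => p pps; have := he p pps; rewrite addnS leq_eqVlt => /orP[/eqP sp|//].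
have p0 : p`_(m.+1 + e) = 0.
  apply: (sum_sqr_eq0 (F := fun p : {poly K} => p`_(m.+1 + e))) pps.
  rewrite -top; first by apply: h; lia.
  by move=> q /he; rewrite addnS.
have : p != 0 by rewrite -size_poly_gt0 sp.
by rewrite -lead_coef_eq0 lead_coefE sp /= p0 eqxx.
Qed.

Lemma formally_real_poly : formally_real {poly K}.
Proof.
move=> ps s0 p pps; apply/polyP => i.
have [|h _] := @coef_sum_sqr_low ps i.+1; first by move=> j _; rewrite s0 coef0.
by rewrite h // coef0.
Qed.

End SumsOfSquares.

Lemma formally_real_realDomain (R : realDomainType) : formally_real R.
Proof.
move=> s /eqP; rewrite psumr_eq0 => [/allP h a /h|a _]; last exact: sqr_ge0.
by rewrite sqrf_eq0 => /eqP.
Qed.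

(** The letters are ordered as in [h]; over a commutative ring this is the Motzkin form
    [x^4 y^2 + x^2 y^4 + z^6 - 3 x^2 y^2 z^2]. *)
Definition motzkin (K : nzRingType) (x y z : K) : K :=
  y ^+ 2 * x ^+ 2 * y ^+ 2 + x ^+ 2 * y ^+ 2 * x ^+ 2 + z ^+ 6
  - 3 * (x * y * z ^+ 2 * y * x).

Lemma rmorph_motzkin (K L : nzRingType) (f : {rmorphism K -> L}) x y z :
  f (motzkin x y z) = motzkin (f x) (f y) (f z).
Proof.
have f3 : f 3 = 3 by rewrite rmorph_nat.
by rewrite /motzkin rmorphB [f (3 * _)]rmorphM f3 !rmorphD !(rmorphXn, rmorphM).
Qed.

Lemma poly3E (K : nzRingType) (p : {poly K}) a :
  (forall j, (j < a)%N -> p`_j = 0) -> (size p <= a.+3)%N ->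
  p = 'X^a * ((p`_a)%:P + p`_a.+1 *: 'X + p`_a.+2 *: 'X^2).
Proof.
move=> lo hi; apply/polyP => i; rewrite coefXnM.
case: ltnP => ia; first exact: lo.
rewrite !coefE; have [->|[->|[->|h]]] : i = a \/ i = a.+1 \/ i = a.+2 \/ (a.+3 <= i)%N by lia.
- by rewrite subnn /= !mulr0 !addr0.
- by rewrite subSnn /= mulr1 mulr0 addr0 add0r.
- by rewrite -addn2 addKn /= mulr1 mulr0 !add0r.
rewrite nth_default; last exact: leq_trans h.
have -> : (i - a = (i - a.+3).+3)%N by lia.
by rewrite /= !mulr0 !addr0.
Qed.

Lemma poly1E (K : nzRingType) (p : {poly K}) a :
  (forall j, (j < a)%N -> p`_j = 0) -> (size p <= a.+1)%N -> p = p`_a *: 'X^a.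
Proof.
move=> lo hi; apply/polyP => i; rewrite coefZ coefXn.
have [->|] := eqVneq i a; first by rewrite mulr1.
rewrite neq_ltn mulr0 => /orP[/lo //|ai].
by rewrite nth_default //; apply: leq_trans ai.
Qed.

(** With inner variable [x] and outer variable [y], each summand is [y^a (u + v y + w y^2)]. The
    squares of the [u] add up to [x^(2a)] and those of the [w] to [x^(2a+2)], so [u] and [w] are
    multiples of [x^a] and [x^(a+1)]. The cross terms [2 u w] then have odd degree and leave the
    coefficient [-3] of [x^(2a+2)] to the squares of the [v]. *)
Lemma motzkin_not_sum_sqr (R : realDomainType) (a : nat)
    (qs : seq {poly {poly R}}) :
  \sum_(q <- qs) q ^+ 2 != ('X^a * ('X^a)%:P) ^+ 2 * motzkin 'X%:P 'X 1.
Proof.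
apply/eqP => qsE.
have realR := @formally_real_realDomain R.
have realRx := formally_real_poly realR.
pose c0 : {poly R} := 'X^(a + a).
pose c2 : {poly R} := c0 * ('X^4 - 3 * 'X^2).
pose c4 : {poly R} := c0 * 'X^2.
have {qsE} qsE : \sum_(q <- qs) q ^+ 2
    = 'X^(a + a) * (c0%:P + c2 *: 'X^2 + c4 *: 'X^4).
  rewrite qsE /motzkin -!mul_polyC /c4 /c2 /c0 !exprD !rmorphM !rmorphB !rmorphM /= !rmorphXn /=.
  rewrite -[3 in LHS](rmorph_nat (@polyC {poly R})) -[3 in RHS](rmorph_nat (@polyC R)); ring.
have cE i : (\sum_(q <- qs) q ^+ 2)`_(a + a + i)
    = if i == 0 then c0 else if i == 2 then c2 else if i == 4 then c4 else 0.
  rewrite qsE coefXnM ltnNge leq_addr /= addKn !coefE.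
  by case: i => [|[|[|[|[|i]]]]] /=; rewrite ?mulr0 ?mulr1 ?addr0 ?add0r.
have [lo c0E] : (forall q, q \in qs -> forall j, (j < a)%N -> q`_j = 0) /\
    (\sum_(q <- qs) q ^+ 2)`_(a + a) = \sum_(q <- qs) q`_a ^+ 2.
  apply: coef_sum_sqr_low => // j ja; rewrite qsE coefXnM.
  by have -> : (j + j < a + a)%N by lia.
have [hi c4E] : (forall q : {poly {poly R}}, q \in qs -> (size q <= a.+3)%N) /\
    (\sum_(q <- qs) q ^+ 2)`_(a.+2 + a.+2) = \sum_(q <- qs) q`_a.+2 ^+ 2.
  apply: size_sum_sqr => // j ja.
  have -> : (j + j = a + a + (j + j - (a + a)))%N by lia.
  by rewrite cE; do 3?[case: ifP => [/eqP|_]; first by lia].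
have {c0E}c0E : \sum_(q <- qs) q`_a ^+ 2 = c0 by rewrite -c0E -[(a + a)%N]addn0 cE.
have {c4E}c4E : \sum_(q <- qs) q`_a.+2 ^+ 2 = c4.
  by rewrite -c4E; have -> : (a.+2 + a.+2 = a + a + 4)%N by lia; rewrite cE.
have c2E : \sum_(q <- qs) q`_a.+1 ^+ 2
    = c2 - \sum_(q <- qs) 2 * (q`_a * q`_a.+2).
  have <- : (\sum_(q <- qs) q ^+ 2)`_(a + a + 2) = c2 by rewrite cE.
  rewrite coef_sum -sumrB; apply: eq_big_seq => q qqs.
  suff -> : (q ^+ 2)`_(a + a + 2) = q`_a.+1 ^+ 2 + 2 * (q`_a * q`_a.+2) by rewrite addrK.
  rewrite [in LHS](poly3E (lo _ qqs) (hi _ qqs)) exprMn -exprM muln2 -addnn.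
  rewrite coefXnM ltnNge leq_addr /= addKn expr2.
  move: q`_a q`_a.+1 q`_a.+2 => u v w.
  by rewrite coefM !big_ord_recr big_ord0 /= !coefE /=; ring.
have uE : {in qs, forall q : {poly {poly R}}, q`_a = (q`_a)`_a *: 'X^a}.
  have := @coef_sum_sqr_low _ realR [seq q`_a | q : {poly {poly R}} <- qs] a.
  have := @size_sum_sqr _ realR [seq q`_a | q : {poly {poly R}} <- qs] a.
  rewrite !big_map c0E => -[j aj|hiu _ [j ja|lou _]].
  - by rewrite coefXn; case: eqP => //; lia.
  - by rewrite coefXn; case: eqP => //; lia.
  move=> q qqs; have q' := map_f (fun q : {poly {poly R}} => q`_a) qqs.
  exact: poly1E (lou _ q') (hiu _ q').
have wE : {in qs, forall q : {poly {poly R}}, q`_a.+2 = (q`_a.+2)`_a.+1 *: 'X^(a.+1)}.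
  have := @coef_sum_sqr_low _ realR [seq q`_a.+2 | q : {poly {poly R}} <- qs] a.+1.
  have := @size_sum_sqr _ realR [seq q`_a.+2 | q : {poly {poly R}} <- qs] a.+1.
  rewrite !big_map c4E /c4 /c0 -exprD => -[j aj|hiu _ [j ja|lou _]].
  - by rewrite coefXn; case: eqP => //; lia.
  - by rewrite coefXn; case: eqP => //; lia.
  move=> q qqs; have q' := map_f (fun q : {poly {poly R}} => q`_a.+2) qqs.
  exact: poly1E (lou _ q') (hiu _ q').
have evenE j : (\sum_(q <- qs) q`_a.+1 ^+ 2)`_(j + j) = c2`_(j + j).
  rewrite c2E coefB coef_sum big_seq big1 ?subr0 // => q qqs.
  rewrite uE // wE // -scalerAl -!scalerAr -exprD !coefZ.
  rewrite mulr_natl coefMn coefXn.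
  by case: eqP => [|_]; [lia|rewrite mul0rn !mulr0].
(* Every [v] has order at least [a + 1], so the coefficient of degree [2a + 2] is a sum of
   squares. *)
have := @coef_sum_sqr_low _ realR [seq q`_a.+1 | q : {poly {poly R}} <- qs] a.+1.
rewrite !big_map => -[j ja|_].
  rewrite evenE /c2 /c0 coefXnM; case: ltnP => // h.
  have -> : (j + j - (a + a) = 0)%N by lia.
  by rewrite -[3](rmorph_nat (@polyC R)) mul_polyC !coefE /= mulr0 subr0.
rewrite evenE /c2 /c0; have -> : (a.+1 + a.+1 = a + a + 2)%N by lia.
rewrite coefXnM ltnNge leq_addr /= addKn.
rewrite -[3](rmorph_nat (@polyC R)) mul_polyC !coefE /= mulr1 sub0r => /eqP.
rewrite lt_eqF // (@lt_le_trans _ _ 0) ?oppr_lt0 ?ltr0n //.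
by apply: sumr_ge0 => p _; exact: sqr_ge0.
Qed.

Lemma motzkin_homogeneous (K : comNzRingType) (l x y z : K) :
  motzkin (l * x) (l * y) (l * z) = l ^+ 6 * motzkin x y z.
Proof. by rewrite /motzkin; ring. Qed.

Lemma size_polyM_le (K : nzRingType) (p q : {poly K}) i j :
  (size p <= i.+1)%N -> (size q <= j.+1)%N -> (size (p * q)%R <= (i + j).+1)%N.
Proof. by move=> pi qj; apply: leq_trans (size_polyMleq _ _) _; lia. Qed.

Lemma coefX_top (K : nzRingType) (p : {poly K}) i N :
  (size p <= i.+1)%N -> (p ^+ N)`_(i * N) = p`_i ^+ N /\ (size (p ^+ N) <= (i * N).+1)%N.
Proof.
move=> pi; elim: N => [|N [IH sN]]; first by rewrite muln0 !expr0 coef1 size_poly1.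
rewrite !exprS mulnS coefM_top // IH; split => //.
exact: size_polyM_le.
Qed.

(** The outermost variable is [l]. The base of the denominator has degree 6 in [l] with leading
    coefficient [x^2 y^2], and the Motzkin factor is [l^6] times its value at [(x, y, 1)]; the top
    coefficients of the summands contradict [motzkin_not_sum_sqr] with [a = 2N]. *)
Lemma motzkin_not_sum_sqr_denom (R : realDomainType) (N : nat)
    (ps : seq {poly {poly {poly R}}}) :
  let x := ('X : {poly R})%:P%:P in let y := ('X : {poly {poly R}})%:P in
  \sum_(p <- ps) p ^+ 2 <>
  (((1 + ('X * x) ^+ 2) * (1 + ('X * y) ^+ 2) * (1 + 'X ^+ 2)) ^+ N) ^+ 2
    * motzkin ('X * x) ('X * y) 'X.
Proof.
move=> x y psE.
have realK := formally_real_poly (formally_real_poly (@formally_real_realDomain R)).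
pose x' : {poly {poly R}} := 'X%:P; pose y' : {poly {poly R}} := 'X.
pose E := (1 + ('X * x) ^+ 2) * (1 + ('X * y) ^+ 2) * (1 + 'X ^+ 2).
have top (c : {poly {poly R}}) : (size (1 + ('X * c%:P) ^+ 2)%R <= 3)%N /\
    (1 + ('X * c%:P) ^+ 2)`_2 = c ^+ 2.
  rewrite mulrC mul_polyC exprZn; split; last by rewrite !coefE /= mulr1 add0r.
  apply/leq_sizeP => j j3; rewrite !coefE.
  by case: j j3 => [|[|[|j]]] //= _; rewrite mulr0 addr0.
have [sx cx] := top x'; have [sy cy] := top y'; have [s1 c1] := top 1.
have {s1 c1}[s1 c1] : (size (1 + 'X ^+ 2 : {poly {poly {poly R}}})%R <= 3)%N /\
    (1 + 'X ^+ 2 : {poly {poly {poly R}}})`_2 = 1.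
  by rewrite -[X in (1 + X ^+ 2)](mulr1 'X) -(polyC1 {poly {poly R}}) c1 expr1n.
have sxy : (size ((1 + ('X * x) ^+ 2) * (1 + ('X * y) ^+ 2))%R <= 5)%N.
  exact: (size_polyM_le sx sy).
have cxy : ((1 + ('X * x) ^+ 2) * (1 + ('X * y) ^+ 2))`_4 = x' ^+ 2 * y' ^+ 2.
  by rewrite (@coefM_top _ _ _ 2 2) // cx cy.
have sE : (size E <= 7)%N by exact: (size_polyM_le sxy s1).
have cE : E`_6 = x' ^+ 2 * y' ^+ 2 by rewrite (@coefM_top _ _ _ 4 2) // cxy c1 mulr1.
have [cEN sEN] := coefX_top (N + N) sE.
pose m := (6 * N + 3)%N.
have {psE} psE : \sum_(p <- ps) p ^+ 2 = E ^+ (N + N) * ((motzkin x' y' 1) *: 'X^6).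
  rewrite psE -/E -exprM muln2 -addnn; congr (_ * _).
  rewrite -{3}['X]mulr1 motzkin_homogeneous -mul_polyC mulrC; congr (_ * _).
  by rewrite rmorph_motzkin rmorph1.
have sM : (size (motzkin x' y' 1 *: 'X^6) <= 7)%N.
  by apply: leq_trans (size_scale_leq _ _) _; rewrite size_polyXn.
have [hi e] : (forall p : {poly {poly {poly R}}}, p \in ps -> (size p <= m.+1)%N) /\
    (\sum_(p <- ps) p ^+ 2)`_(m + m) = \sum_(p <- ps) p`_m ^+ 2.
  apply: (size_sum_sqr realK) => j mj; rewrite psE nth_default //.
  by apply: leq_trans (size_polyM_le sEN sM) _; lia.
have := motzkin_not_sum_sqr (2 * N) [seq p`_m | p : {poly {poly {poly R}}} <- ps].
rewrite big_map -e psE; have -> : (m + m = 6 * (N + N) + 6)%N by lia.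
rewrite coefM_top // cEN cE coefZ coefXn eqxx mulr1 => /eqP; apply.
congr (_ * _); rewrite /x' /y' rmorphXn /= exprMn -!exprM exprMn -!exprM mulrC.
by congr (_ ^+ _ * _ ^+ _); lia.
Qed.

(** * Rational functions in three variables as an algebra *)

Section RationalFunctions.
Variable R : idomainType.

(** A named copy of the fraction field, to carry the scaling by [R] that [ratalg_universal] asks of
    its target. *)
Definition ratfun : Type := {fraction {poly {poly {poly R}}}}.
HB.instance Definition _ := GRing.Field.on ratfun.

Definition ratfun_frac (p : {poly {poly {poly R}}}) : ratfun := tofrac p.
HB.instance Definition _ := GRing.RMorphism.copy ratfun_frac (@tofrac {poly {poly {poly R}}}).

Lemma ratfun_frac_inj : injective ratfun_frac.
Proof. by move=> p q /eqP; rewrite tofrac_eq => /eqP. Qed.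

Definition ratfun_scale (c : R) (f : ratfun) : ratfun := ratfun_frac c%:P%:P%:P * f.

Fact ratfun_scaleA a b f : ratfun_scale a (ratfun_scale b f) = ratfun_scale (a * b) f.
Proof. by rewrite /ratfun_scale !rmorphM mulrA. Qed.
Fact ratfun_scale1 : left_id 1 ratfun_scale.
Proof. by move=> f; rewrite /ratfun_scale !polyC1 rmorph1 mul1r. Qed.
Fact ratfun_scaleDr : right_distributive ratfun_scale +%R.
Proof. by move=> c f g; rewrite /ratfun_scale mulrDr. Qed.
Fact ratfun_scaleDl f : {morph ratfun_scale^~ f : a b / a + b}.
Proof. by move=> a b; rewrite /ratfun_scale !rmorphD mulrDl. Qed.
HB.instance Definition _ := GRing.Zmodule_isLmodule.Build R ratfun
  ratfun_scaleA ratfun_scale1 ratfun_scaleDr ratfun_scaleDl.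

Fact ratfun_scaleAl (c : R) (f g : ratfun) : c *: (f * g) = (c *: f) * g.
Proof. by rewrite /GRing.scale /= /ratfun_scale mulrA. Qed.
HB.instance Definition _ := GRing.Lmodule_isLalgebra.Build R ratfun ratfun_scaleAl.

Fact ratfun_scaleAr (c : R) (f g : ratfun) : c *: (f * g) = f * (c *: g).
Proof. by rewrite /GRing.scale /= /ratfun_scale mulrCA. Qed.
HB.instance Definition _ := GRing.Lalgebra_isAlgebra.Build R ratfun ratfun_scaleAr.

Lemma ratfun_scaleE c (f : ratfun) : c *: f = ratfun_frac c%:P%:P%:P * f.
Proof. by []. Qed.

End RationalFunctions.

(** * The commutative image of the rational algebra *)

Lemma ncpoly_alg_ind (R : comNzRingType) (I : choiceType) (P : ncpoly R I -> Prop) :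
  P 1 -> (forall p q, P p -> P q -> P (p + q)) ->
  (forall p q, P p -> P q -> P (p * q)) -> (forall c p, P p -> P (c *: p)) ->
  (forall i, P (ncX i)) -> forall p, P p.
Proof.
move=> P1 PD PM PZ PX; elim/ncpoly_ind => [|//|a [s]].
  by rewrite -(scale0r (1 : ncpoly R I)); exact: PZ.
rewrite -[a]mulr1 -ncpoly_scaleU; apply: PZ; elim: s => [|i s IH].
  suff -> : ncmon 1 (FMonom [::]) = 1 :> ncpoly R I by [].
  by congr ncmon; apply: val_inj; rewrite /= fm1.
suff -> : ncmon 1 (FMonom (i :: s)) = ncX i * ncmon 1 (FMonom s) :> ncpoly R I.
  exact: PM.
by rewrite ncpoly_mulU mulr1; congr ncmon; apply: val_inj; rewrite /= fmM fmU.
Qed.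

Section RatalgInduction.
Context {R : comNzRingType} {n : nat}.

Definition ratV (j : 'I_n) : ratalg R n := ratpi (ncX (inr j)).

Lemma ratalg_ind (P : ratalg R n -> Prop) :
  P 1 -> (forall a b, P a -> P b -> P (a + b)) ->
  (forall a b, P a -> P b -> P (a * b)) -> (forall c a, P a -> P (c *: a)) ->
  (forall j, P (ratX R j)) -> (forall j, P (ratV j)) -> forall a, P a.
Proof.
move=> P1 PD PM PZ PX PV a; have [p ->] := ratpi_surj a.
elim/ncpoly_alg_ind: p => [|p q Pp Pq|p q Pp Pq|c p Pp|[j|j]].
- by rewrite rmorph1.
- by rewrite rmorphD; exact: PD.
- by rewrite rmorphM; exact: PM.
- by rewrite linearZ; exact: PZ.
- exact: PX.
- exact: PV.
Qed.

Lemma ratstarV j : ratstar (ratV j) = ratV j.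
Proof. by rewrite ratpi_star ncstarX. Qed.

Lemma ratstar1 : ratstar (1 : ratalg R n) = 1.
Proof. by rewrite -[1](rmorph1 (@ratpi R n)) ratpi_star ncstar1. Qed.

(** The star fixes the generators and only reverses products, which a commutative image does not
    see. *)
Lemma lrmorphism_ratstar (B : algType R) (f : {lrmorphism ratalg R n -> B}) :
  (forall a b, f a * f b = f b * f a) -> forall a, f (ratstar a) = f a.
Proof.
move=> fC; elim/ratalg_ind => [|a b IHa IHb|a b IHa IHb|c a IH|j|j].
- by rewrite ratstar1.
- by rewrite ratstarD !rmorphD /= IHa IHb.
- by rewrite ratstarM !rmorphM /= IHa IHb fC.
- by rewrite ratstarZ !linearZ /= IH.
- by rewrite ratstarX.
- by rewrite ratstarV.
Qed.

End RatalgInduction.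

(** * Exclusion from the cone by a commutative evaluation *)

Section NotInCone.
Context {R : realType} {n : nat}.

Let F := ratfun R.
Let frac : {rmorphism {poly {poly {poly R}}} -> F} := @ratfun_frac R.
Let x : {poly {poly {poly R}}} := 'X%:P%:P.
Let y : {poly {poly {poly R}}} := 'X%:P.
Let D : {poly {poly {poly R}}} :=
  (1 + ('X * x) ^+ 2) * (1 + ('X * y) ^+ 2) * (1 + 'X ^+ 2).

(** The common factor [l], the outermost variable, makes the image of [h] homogeneous of degree 6 in
    [l]. [D] is a common multiple of all the [1 + g j ^+ 2]. *)
Let g (j : 'I_n) : {poly {poly {poly R}}} :=
  match val j with 0 => 'X * x | 1 => 'X * y | 2 => 'X | _ => 0 end.

Let g_dvd j : exists r, D = (1 + g j ^+ 2) * r.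
Proof.
rewrite /g; case: (val j) => [|[|[|k]]].
- by exists ((1 + ('X * y) ^+ 2) * (1 + 'X ^+ 2)); rewrite mulrA.
- by exists ((1 + ('X * x) ^+ 2) * (1 + 'X ^+ 2)); rewrite mulrA [_ * (1 + ('X * x) ^+ 2)]mulrC.
- by exists ((1 + ('X * x) ^+ 2) * (1 + ('X * y) ^+ 2)); rewrite mulrC.
- by exists D; rewrite expr0n addr0 mul1r.
Qed.

Let g_neq0 j : 1 + g j ^+ 2 != 0.
Proof.
apply/eqP => h.
have realP := formally_real_poly (formally_real_poly
  (formally_real_poly (@formally_real_realDomain R))).
have := realP [:: 1; g j]; rewrite !big_cons big_nil addr0 expr1n => /(_ h 1).
by rewrite mem_head => /(_ isT) /eqP; rewrite oner_eq0.
Qed.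

Let eval_exists : exists f : {lrmorphism ratalg R n -> F},
  forall j, f (ratX R j) = frac (g j).
Proof.
have [j|f fX _] := @ratalg_universal R n F (fun j => frac (g j)); last by exists f.
have h : 1 + frac (g j) ^+ 2 != 0.
  rewrite -rmorphXn -(rmorph1 frac) -rmorphD -(rmorph0 frac).
  by rewrite (inj_eq (@ratfun_frac_inj R)) g_neq0.
by exists (1 + frac (g j) ^+ 2)^-1; rewrite mulfV ?mulVf.
Qed.

Lemma motzkin_notin_coneK (h : ncsa R n) (i1 i2 i3 : 'I_n) :
  val i1 = 0%N -> val i2 = 1%N -> val i3 = 2%N ->
  val h = motzkin (ncX i1) (ncX i2) (ncX i3) -> ~ coneK R n h.
Proof.
move=> e1 e2 e3 hE [a [b [[s ->] [t ->]]]]; rewrite hE => embE.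
have [f fX] := eval_exists.
have fV j : f (ratV j) * (1 + frac (g j) ^+ 2) = 1.
  have [_ xv] := @ratX_invr R n j.
  by rewrite -fX -rmorphXn -(rmorph1 f) -rmorphD -rmorphM xv.
have [d d_dvd dE] : exists2 d, forall j, exists r, d = (1 + g j ^+ 2) * r & d = D by exists D.
(* Every element is built from the [ratX] and [ratV], and one factor [d] clears each [ratV]. *)
have clear c : exists N p, f c * frac d ^+ N = frac p.
  move: c; elim/(@ratalg_ind R n) => [|c c' [N [p Np]] [M [q Mq]]|c c' [N [p Np]] [M [q Mq]]|k c [N [p Np]]|j|j].
  - by exists 0%N, 1; rewrite !rmorph1 mul1r.
  - exists (N + M)%N, (p * d ^+ M + q * d ^+ N).
    by rewrite !(rmorphD, rmorphM, rmorphXn) /= -Np -Mq exprD; ring.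
  - exists (N + M)%N, (p * q).
    by rewrite !(rmorphD, rmorphM, rmorphXn) /= -Np -Mq exprD; ring.
  - by exists N, (k%:P%:P%:P * p); rewrite linearZ /= ratfun_scaleE rmorphM /= -Np mulrA.
  - by exists 0%N, (g j); rewrite mulr1 fX.
  - have [r Dr] := d_dvd j; exists 1%N, r.
    by rewrite expr1 Dr rmorphM rmorphD rmorphXn rmorph1 mulrA fV mul1r.
(* One exponent for the whole list: a new element with exponent [M] multiplies the earlier
   numerators by [d ^+ M] and its own by [d ^+ N]. *)
have [N [ps psE]] : exists N (ps : seq {poly {poly {poly R}}}),
    [seq f c * frac d ^+ N | c <- s] = [seq frac p | p <- ps].
  elim: s {embE} => [|c s [N [ps IH]]]; first by exists 0%N, [::].
  have [M [p Mp]] := clear c.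
  exists (N + M)%N, (p * d ^+ N :: [seq p * d ^+ M | p <- ps]) => /=; congr (_ :: _).
    by rewrite rmorphM rmorphXn /= -Mp exprD; ring.
  rewrite -map_comp; have -> : [seq (frac \o *%R^~ (d ^+ M)) p | p <- ps] =
    [seq u * frac d ^+ M | u <- [seq frac p | p <- ps]].
    by rewrite -map_comp; apply: eq_map => q /=; rewrite rmorphM rmorphXn.
  by rewrite -IH -map_comp; apply: eq_map => q /=; rewrite exprD mulrA.
have starE := lrmorphism_ratstar (fun a b => mulrC (f a) (f b)).
apply: (@motzkin_not_sum_sqr_denom R N ps); rewrite -/x -/y -/D -dE.
apply: (@ratfun_frac_inj R); rewrite -/frac.
rewrite rmorph_sum rmorphM.
under eq_bigr do rewrite rmorphXn.
rewrite -(big_map frac xpredT (fun u => u ^+ 2)) -psE big_map.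
(* In the field the commutators vanish and the star acts trivially. *)
have {embE} : f (ratembed (motzkin (ncX i1) (ncX i2) (ncX i3))) = \sum_(c <- s) f c ^+ 2.
  rewrite embE rmorphD rmorph_sum [X in _ + X]rmorph_sum [X in _ + X]big1.
    by rewrite addr0; apply: eq_bigr => c _; rewrite rmorphM /= starE.
  by move=> u _; rewrite /= linearZ /= rmorphB !rmorphM /= [f u.2 * _]mulrC subrr scaler0.
have -> : f (ratembed (motzkin (ncX i1) (ncX i2) (ncX i3))) = frac (motzkin ('X * x) ('X * y) 'X).
  have fx j : f (ratembed (ncX j)) = frac (g j) by rewrite /ratembed ncevalX fX.
  by rewrite !rmorph_motzkin /= !fx /g e1 e2 e3.
move=> ->; rewrite !rmorphXn mulr_sumr; apply: eq_bigr => c _.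
by rewrite exprMn mulrC.
Qed.

End NotInCone.

(** * Positivity modulo commutators *)

Section TracialCone.
Context {R : realType} {n : nat}.
Local Notation A := (ratalg R n).
Implicit Types (a b u v w x y z : A).

Lemma ratstarN a : ratstar (- a) = - ratstar a.
Proof. by rewrite -scaleN1r ratstarZ scaleN1r. Qed.

Lemma ratstarB a b : ratstar (a - b) = ratstar a - ratstar b.
Proof. by rewrite ratstarD ratstarN. Qed.

(** [coneK] is the preimage of this cone under [ratembed]; arguing in the whole of A leaves room for
    elements that are not polynomials. *)
Definition tracial_cone : set A :=
  [set p | exists a b, [/\ sum_of_squares a, commutator_span b & p = a + b]].

Definition cyceq x y := @commutator_span R n (x - y).

Lemma commutator_spanD a b :
  commutator_span a -> commutator_span b -> commutator_span (a + b).
Proof.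
by move=> [s ->] [t ->]; exists (s ++ t); rewrite big_cat.
Qed.

Lemma commutator_spanZ (c : R) a : commutator_span a -> commutator_span (c *: a).
Proof.
move=> [s ->]; exists [seq (c * t.1.1, t.1.2, t.2) | t <- s].
by rewrite big_map scaler_sumr; apply: eq_bigr => t _; rewrite scalerA.
Qed.

Lemma cyceq_refl x : cyceq x x.
Proof. by exists [::]; rewrite subrr big_nil. Qed.

Lemma cyceqC u v : cyceq (u * v) (v * u).
Proof. by exists [:: (1, u, v)]; rewrite big_seq1 scale1r. Qed.

Lemma cyceq_sym x y : cyceq x y -> cyceq y x.
Proof. by move/(commutator_spanZ (-1)); rewrite scaleN1r opprB. Qed.

Lemma cyceqD x y u v : cyceq x y -> cyceq u v -> cyceq (x + u) (y + v).
Proof. by move=> h /(commutator_spanD h); rewrite /cyceq opprD addrACA. Qed.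

Lemma cyceqZ (c : R) x y : cyceq x y -> cyceq (c *: x) (c *: y).
Proof. by move/(commutator_spanZ c); rewrite /cyceq scalerBr. Qed.

Lemma cyceqN x y : cyceq x y -> cyceq (- x) (- y).
Proof. by move/(cyceqZ (-1)); rewrite !scaleN1r. Qed.

Lemma cyceqB x y u v : cyceq x y -> cyceq u v -> cyceq (x - u) (y - v).
Proof. by move=> h /cyceqN; exact: cyceqD. Qed.

Lemma tracial_coneD x y : tracial_cone x -> tracial_cone y -> tracial_cone (x + y).
Proof.
move=> [a [b [[s ->] hb ->]]] [c [d [[t ->] hd ->]]].
exists (\sum_(u <- s ++ t) u * ratstar u), (b + d); split; last by rewrite big_cat addrACA.
  by exists (s ++ t).
exact: commutator_spanD.
Qed.

Lemma tracial_coneZ (c : R) x : 0 <= c -> tracial_cone x -> tracial_cone (c *: x).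
Proof.
move=> c0 [a [b [[s ->] hb ->]]].
exists (c *: \sum_(u <- s) u * ratstar u), (c *: b); split; last by rewrite scalerDr.
  exists [seq Num.sqrt c *: u | u <- s]; rewrite big_map scaler_sumr; apply: eq_bigr => u _.
  by rewrite ratstarZ -scalerAl -scalerAr scalerA -expr2 sqr_sqrtr.
exact: commutator_spanZ.
Qed.

Lemma tracial_cone_sqr u : tracial_cone (u * ratstar u).
Proof.
exists (u * ratstar u), 0; rewrite addr0; split=> //.
  by exists [:: u]; rewrite big_seq1.
by exists [::]; rewrite big_nil.
Qed.

Lemma tracial_cone0 : tracial_cone 0.
Proof. by rewrite -(mul0r (ratstar 0)); exact: tracial_cone_sqr. Qed.

Lemma tracial_cone_cyceq x y : cyceq y x -> tracial_cone x -> tracial_cone y.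
Proof.
move=> yx [a [b [ha hb xE]]]; exists a, (b + (y - x)); split=> //.
  exact: commutator_spanD.
by rewrite addrA -xE addrC subrK.
Qed.

Definition tracial_le x y := tracial_cone (y - x).
Local Notation "x <~ y" := (tracial_le x y) (at level 70).

Lemma tracial_le_trans y x z : x <~ y -> y <~ z -> x <~ z.
Proof. by move=> h /tracial_coneD/(_ h); rewrite /tracial_le addrA subrK. Qed.

Lemma tracial_leD x y u v : x <~ y -> u <~ v -> x + u <~ y + v.
Proof. by move=> h /(tracial_coneD h); rewrite /tracial_le opprD addrACA. Qed.

Lemma tracial_leZ (c : R) x y : 0 <= c -> x <~ y -> c *: x <~ c *: y.
Proof. by move=> c0 /(tracial_coneZ c0); rewrite /tracial_le scalerBr. Qed.

Lemma tracial_le_cyceq x y : cyceq x y -> x <~ y.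
Proof.
by move/cyceq_sym => yx; exists 0, (y - x); rewrite add0r; split=> //; exists [::]; rewrite big_nil.
Qed.

Lemma tracial_le_refl x : x <~ x.
Proof. exact/tracial_le_cyceq/cyceq_refl. Qed.

Lemma tracial_leD2r z x y : x + z <~ y + z -> x <~ y.
Proof. by rewrite /tracial_le opprD addrACA subrr addr0. Qed.

(** Modulo commutators, the hermitian square of [p * q - q * p] is twice the right side minus the
    left. *)
Lemma tracial_commutator p q : ratstar p = p -> ratstar q = q ->
  p * q * p * q <~ p ^+ 2 * q ^+ 2.
Proof.
move=> ps qs; have := tracial_cone_sqr (p * q - q * p).
rewrite ratstarB !ratstarM ps qs mulrBl !mulrBr => h.
suff : tracial_cone (2^-1 *: (p ^+ 2 * q ^+ 2 - p * q * p * q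
    - (p * q * p * q - p ^+ 2 * q ^+ 2))).
  by rewrite [- (_ - _ ^+ 2 * _)]opprB -mulr2n -scaler_nat scalerA mulVf
    ?pnatr_eq0 // scale1r.
apply: tracial_coneZ; first by rewrite invr_ge0.
apply: tracial_cone_cyceq h; apply: cyceqB; apply: cyceqB.
- by have := cyceqC p (p * q * q); rewrite !expr2 !mulrA.
- by rewrite !mulrA; apply: cyceq_refl.
- by have := cyceqC p (q * p * q); rewrite !mulrA.
by have := cyceqC (p * p * q) q; rewrite !expr2 !mulrA.
Qed.


(* A stand-in for the subalgebra generated by x_j and (1 + x_j ^ 2)^-1: commutative,
   with trivial involution, and needing no normal form for its elements. *)
Definition bicommutant (j : 'I_n) : set A :=
  [set a | ratstar a = a /\ forall u, u * ratX R j = ratX R j * u -> u * a = a * u].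

(** These play the part of nonnegative functions of [x_j]: as [bicommutant] is commutative, they are
    closed under products as well as sums. *)
Definition bisos (j : 'I_n) : set A :=
  [set a | exists2 s : seq A, (forall u, u \in s -> bicommutant j u) &
    a = \sum_(u <- s) u ^+ 2].

(** * Positive functions of one variable *)

Section Univariate.
Variable j : 'I_n.
Local Notation C := (bicommutant j).
Local Notation S := (bisos j).
Local Notation t := (ratX R j).

Lemma bicommutantX : C t.
Proof. by split=> [|u //]; exact: ratstarX. Qed.

Lemma bicommutant_comm a b : C a -> C b -> a * b = b * a.
Proof. by move=> [_ ha] [_ hb]; apply: hb; rewrite -ha. Qed.

Lemma bicommutant1 : C 1.
Proof. by split=> [|u _]; [exact: ratstar1|rewrite mul1r mulr1]. Qed.

Lemma bicommutantD a b : C a -> C b -> C (a + b).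
Proof.
move=> [sa ha] [sb hb]; split=> [|u ut]; first by rewrite ratstarD sa sb.
by rewrite mulrDr mulrDl ha // hb.
Qed.

Lemma bicommutantM a b : C a -> C b -> C (a * b).
Proof.
move=> Ca Cb; split=> [|u ut]; last first.
  by rewrite mulrA Ca.2 // -mulrA Cb.2 // mulrA.
by rewrite ratstarM Ca.1 Cb.1; apply: bicommutant_comm.
Qed.

Lemma bicommutantZ (c : R) a : C a -> C (c *: a).
Proof.
move=> [sa ha]; split=> [|u ut]; first by rewrite ratstarZ sa.
by rewrite -scalerAr -scalerAl ha.
Qed.

Lemma bicommutantX_exp a k : C a -> C (a ^+ k).
Proof.
move=> Ca; elim: k => [|k IH]; first exact: bicommutant1.
by rewrite exprS; apply: bicommutantM.
Qed.

Lemma bicommutant_sum (T : eqType) (s : seq T) (F : T -> A) :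
  (forall i, i \in s -> C (F i)) -> C (\sum_(i <- s) F i).
Proof.
move=> h; rewrite big_seq; apply: big_ind => //; last exact: bicommutantD.
by rewrite -(scale0r 1); apply: bicommutantZ; exact: bicommutant1.
Qed.

Lemma bicommutantV : C (ratV j).
Proof.
split=> [|u ut]; first exact: ratstarV.
have [xv vx] := @ratX_invr R n j; rewrite -/(ratV j) in xv vx.
have uX : u * (1 + t ^+ 2) = (1 + t ^+ 2) * u.
  by rewrite mulrDr mulrDl mulr1 mul1r expr2 mulrA ut -mulrA ut mulrA.
by rewrite -[LHS]mul1r -vx -mulrA [_ * (u * _)]mulrA -uX -!mulrA xv mulr1.
Qed.

Lemma bisos_bicommutant a : S a -> C a.
Proof.
by move=> [s hs ->]; apply: bicommutant_sum => u /hs; exact: bicommutantX_exp.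
Qed.

Lemma bisos_sqr a : C a -> S (a ^+ 2).
Proof.
by move=> Ca; exists [:: a]; [move=> u; rewrite inE => /eqP ->|rewrite big_seq1].
Qed.

Lemma bisosD a b : S a -> S b -> S (a + b).
Proof.
move=> [s hs ->] [r hr ->]; exists (s ++ r); last by rewrite big_cat.
by move=> u; rewrite mem_cat => /orP[/hs|/hr].
Qed.

Lemma bisosZ (c : R) a : 0 <= c -> S a -> S (c *: a).
Proof.
move=> c0 [s hs ->]; exists [seq Num.sqrt c *: u | u <- s].
  by move=> _ /mapP[u /hs Cu ->]; exact: bicommutantZ.
rewrite big_map scaler_sumr; apply: eq_bigr => u _.
by rewrite exprZn sqr_sqrtr.
Qed.

Lemma bisosM a b : S a -> S b -> S (a * b).
Proof.
move=> [s hs ->] [r hr ->]; exists [seq u * v | u <- s, v <- r].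
  by move=> _ /allpairsP[[u v] /= [/hs Cu /hr Cv ->]]; exact: bicommutantM.
rewrite big_allpairs_dep mulr_suml; apply: eq_big_seq => u /hs Cu.
rewrite mulr_sumr; apply: eq_big_seq => v /hr Cv.
by rewrite exprMn_comm //; apply: bicommutant_comm.
Qed.

Lemma bisos1 : S 1.
Proof. by rewrite -(expr1n A 2); apply: bisos_sqr; exact: bicommutant1. Qed.

Lemma bisos0 : S 0.
Proof. by exists [::]; rewrite ?big_nil. Qed.

Lemma bisosX a k : S a -> S (a ^+ k).
Proof.
move=> Sa; elim: k => [|k IH]; first exact: bisos1.
by rewrite exprS; apply: bisosM.
Qed.

Lemma bisos_sum (T : Type) (s : seq T) (F : T -> A) :
  (forall i, S (F i)) -> S (\sum_(i <- s) F i).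
Proof. by move=> h; apply: big_ind => //; [exact: bisos0|exact: bisosD]. Qed.

Lemma bisos_monoX a b k : S a -> S (b - a) -> S (b ^+ k - a ^+ k).
Proof.
move=> Sa Sba; have Sb : S b by rewrite -[b](subrK a); exact: bisosD.
elim: k => [|k IH]; first by rewrite !expr0 subrr; exact: bisos0.
have -> : b ^+ k.+1 - a ^+ k.+1 = b ^+ k * (b - a) + (b ^+ k - a ^+ k) * a.
  by rewrite !exprSr mulrBr mulrBl addrA subrK.
by apply: bisosD; apply: bisosM => //; exact: bisosX.
Qed.

(** Compared term by term: [a ^+ i] and [1 - a ^+ i] are sums of squares. *)
Lemma bisos_horner_nneg a (p : {poly R}) : S a -> S (1 - a) ->
  (forall i, 0 <= p`_i) ->
  S (horner_alg a p) /\ S (p.[1]%:A - horner_alg a p).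
Proof.
move=> Sa S1a p0.
have pE : horner_alg a p = \sum_(i < size p) p`_i *: a ^+ i.
  rewrite -{1}[p]coefK poly_def linear_sum; apply: eq_bigr => i _ /=.
  by rewrite linearZ rmorphXn /= mulr_algl horner_algX.
rewrite pE; split.
  by apply: bisos_sum => i; apply: bisosZ; [exact: p0|exact: bisosX].
have -> : p.[1]%:A = \sum_(i < size p) p`_i *: 1 ^+ i :> A.
  rewrite horner_coef scaler_suml; apply: eq_bigr => i _.
  by rewrite !expr1n mulr1.
rewrite -sumrB; apply: bisos_sum => i; rewrite -scalerBr.
by apply: bisosZ; [exact: p0|exact: bisos_monoX].
Qed.

Lemma tracial_cone_conj u a : S a -> tracial_cone (u * a * ratstar u).
Proof.
move=> [s hs ->]; rewrite mulr_sumr mulr_suml big_seq.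
apply: big_ind => [||v /hs [sv _]]; [exact: tracial_cone0|exact: tracial_coneD|].
suff -> : u * v ^+ 2 * ratstar u = u * v * ratstar (u * v) by exact: tracial_cone_sqr.
by rewrite ratstarM sv expr2 !mulrA.
Qed.

End Univariate.
End TracialCone.
Notation "x <~ y" := (tracial_le x y) (at level 70) : ring_scope.

(** * Approximating the absolute value *)

Section SqrtIteration.
Variable R : realType.

(* Iterates of [r = (x + r ^+ 2) / 2], whose fixed point is [1 - Num.sqrt (1 - x)]. The
   coefficients are nonnegative and increase with [k], so the estimates on [0, 1] are
   certified by sums of squares. *)
Fixpoint one_sub_sqrt (k : nat) : {poly R} :=
  if k is k'.+1 then 2^-1 *: ('X + one_sub_sqrt k' ^+ 2) else 0.

Lemma one_sub_sqrtS k : 2 * one_sub_sqrt k.+1 = 'X + one_sub_sqrt k ^+ 2.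
Proof. by rewrite /= mulr_natl -scaler_nat scalerA mulfV ?pnatr_eq0 // scale1r. Qed.

Lemma coefM_ge0 (p q : {poly R}) : (forall i, 0 <= p`_i) -> (forall i, 0 <= q`_i) ->
  forall i, 0 <= (p * q)`_i.
Proof. by move=> p0 q0 i; rewrite coefM sumr_ge0 // => l _; exact: mulr_ge0. Qed.

(** Each increment is half the previous one times the sum of two consecutive iterates. *)
Lemma one_sub_sqrt_nneg k : (forall i, 0 <= (one_sub_sqrt k)`_i) /\
  (forall i, 0 <= (one_sub_sqrt k.+1 - one_sub_sqrt k)`_i).
Proof.
elim: k => [|k [IH1 IH2]].
  split=> i; first by rewrite coef0.
  by rewrite /= expr0n addr0 subr0 coefZ coefX mulr_ge0 ?invr_ge0 ?ler0n.
have h i : 0 <= (one_sub_sqrt k.+1)`_i.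
  by rewrite -[one_sub_sqrt k.+1](subrK (one_sub_sqrt k)) coefD addr_ge0.
split=> // i; have -> : one_sub_sqrt k.+2 - one_sub_sqrt k.+1 =
    2^-1 *: ((one_sub_sqrt k.+1 - one_sub_sqrt k) * (one_sub_sqrt k.+1 + one_sub_sqrt k)).
  rewrite -subr_sqr [LHS]/= -scalerBr; congr (_ *: _).
  by rewrite opprD addrACA subrr add0r.
rewrite coefZ mulr_ge0 ?invr_ge0 //; apply: coefM_ge0 => // l.
by rewrite coefD addr_ge0.
Qed.

(** The increments thus measure how far [1 - one_sub_sqrt k] is from being a square root of
    [1 - 'X]. *)
Lemma one_sub_sqrt_gap k :
  2 * (one_sub_sqrt k.+1 - one_sub_sqrt k) = (1 - one_sub_sqrt k) ^+ 2 - (1 - 'X).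
Proof. by rewrite mulrBr one_sub_sqrtS; ring. Qed.

Lemma one_sub_sqrt1 k : 0 <= 1 - (one_sub_sqrt k).[1] /\
  k.+2%:R * (1 - (one_sub_sqrt k).[1]) <= 2.
Proof.
elim: k => [|k []]; first by rewrite horner0 subr0 mulr1 ler01 lexx.
rewrite /= !hornerE ?expr1n -[k.+3%:R]natr1; set r := (one_sub_sqrt k).[1].
have -> : 1 - 2^-1 * (1 + r * r) = (1 - r) - (1 - r) ^+ 2 / 2 by field.
have : (2 : R) <= k.+2%:R by rewrite ler_nat.
move: k.+2%:R (1 - r) => s u s2 u0 su.
have u1 : u <= 1 by nra.
split; first by nra.
(* Expanded, [(s + 1) u - s u^2 / 2 <= 2], which is stronger than the goal. *)
have : 0 <= (2 - s * u) * (2 - u) by apply: mulr_ge0; lra.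
nra.
Qed.

Lemma one_sub_sqrt1_cvg (e : R) : 0 < e -> exists k, (1 - (one_sub_sqrt k).[1]) ^+ 2 <= e.
Proof.
(* With [s = k + 2 > 4 / e], the bound [s t <= 2] gives [t^2 <= 4 / s^2 <= 4 / s < e]. *)
move=> e0; pose k := Num.bound (4 / e); exists k.
have [t0 kt] := one_sub_sqrt1 k; move: t0 kt; set t := 1 - _ => t0 kt.
have ke : 4 < k.+2%:R * e.
  rewrite -ltr_pdivrMr //; apply: lt_trans (archi_boundP _) _.
    by rewrite divr_ge0 // ltW.
  by rewrite ltr_nat ltnS leqnSn.
have : (2 : R) <= k.+2%:R by rewrite ler_nat.
move: k.+2%:R kt ke => s st se s2.
have st0 : 0 <= s * t by apply: mulr_ge0 => //; lra.
have st2 : (s * t) ^+ 2 <= 4 by move: (s * t) st st0 => u; nra.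
have s1 : s <= s ^+ 2 by nra.
have se2 : s * e <= s ^+ 2 * e by apply: ler_wpM2r => //; exact: ltW.
rewrite -(ler_pM2l (_ : 0 < s ^+ 2)) -?exprMn; last by nra.
lra.
Qed.

End SqrtIteration.

(** A polynomial in [t], so that the error of a rational approximation remains in the free
    algebra. *)
Definition abs_err (R : unitRingType) (B : algType R) (t : B) : B :=
  (2^-1 *: (1 + t ^+ 2)) ^+ 2.

Section Approximation.
Context {R : realType} {n : nat}.
Variable j : 'I_n.
Local Notation A := (ratalg R n).
Local Notation C := (@bicommutant R n j).
Local Notation S := (@bisos R n j).
Local Notation t := (ratX R j).
Local Notation v := (@ratV R n j).

Lemma bisos_one_addX2 : S (1 + t ^+ 2).
Proof. by apply: bisosD; [exact: bisos1|apply: bisos_sqr; exact: bicommutantX]. Qed.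

(* [alpha >= |t|] with [alpha ^+ 2 - t ^+ 2 <= e * ((1 + t ^+ 2) / 2) ^+ 2]:
   [|t| = (1 + t ^+ 2) / 2 * Num.sqrt (1 - w ^+ 2)] for
   [w = (1 - t ^+ 2) / (1 + t ^+ 2) = 2 * v - 1]. *)
Lemma abs_approx (e : R) : 0 < e -> exists alpha : A,
  [/\ S alpha, S (alpha ^+ 2 - t ^+ 2) &
      S (t ^+ 2 + e *: abs_err t - alpha ^+ 2)].
Proof.
move=> e0; have [k ke] := one_sub_sqrt1_cvg e0.
have Ct := @bicommutantX R n j; have Cv := @bicommutantV R n j.
have [tv vt] := @ratX_invr R n j; rewrite -/v in tv vt.
have comm := @bicommutant_comm R n j.
have tvC : t * v = v * t by exact: comm.
pose b : A := 2^-1 *: (1 + t ^+ 2).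
have Sb : S b by apply: bisosZ; [rewrite invr_ge0|exact: bisos_one_addX2].
have Cb := bisos_bicommutant Sb.
have errE : abs_err t = b ^+ 2 by [].
(* [1 - x = 4 v (1 - v) = (2 t v)^2], so both [x] and [1 - x] are sums of squares. *)
pose w : A := v *+ 2 - 1; pose x := w ^+ 2.
have Cw : C w.
  apply: bicommutantD; first by rewrite -scaler_nat; exact: bicommutantZ.
  by rewrite -scaleN1r; apply: bicommutantZ; exact: bicommutant1.
have Sx : S x by exact: bisos_sqr.
have v1 : 1 - v = t ^+ 2 * v by rewrite -{1}tv mulrDl mul1r addrC addKr.
have x1 : 1 - x = (v * (t ^+ 2 * v)) *+ 4.
  rewrite /x /w sqrrB1 -v1 mulrBr mulr1 mulrnBl exprMn_n -mulrnA.
  by rewrite opprD addrCA subrr addr0 opprB expr2.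
have S1x : S (1 - x).
  have -> : 1 - x = 4 *: (t * v) ^+ 2.
    by rewrite x1 scaler_nat; congr (_ *+ _); rewrite [in RHS]expr2 {1}tvC expr2 !mulrA.
  by apply: bisosZ => //; apply: bisos_sqr; exact: bicommutantM.
have bx : b ^+ 2 * (1 - x) = t ^+ 2.
  have sC : (1 + t ^+ 2) * t ^+ 2 = t ^+ 2 * (1 + t ^+ 2).
    by rewrite mulrDl mulrDr mul1r mulr1.
  rewrite x1 /b exprZn mulrnAr -scalerAl -scaler_nat scalerA.
  rewrite (_ : 4 * 2^-1 ^+ 2 = 1) ?scale1r; last by field.
  rewrite [(1 + _) ^+ 2]expr2 -mulrA [X in _ * X]mulrA tv mul1r.
  by rewrite mulrA sC -mulrA tv mulr1.
(* At [x], [d] is the error [(1 - r)^2 - (1 - x)]; its nonnegative coefficients bound it by its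
   value at 1, which is at most [e]. *)
pose r := one_sub_sqrt R k; pose d := 2 * (one_sub_sqrt R k.+1 - r).
have [r0 d0'] := one_sub_sqrt_nneg R k.
have d0 i : 0 <= d`_i by rewrite /d mulr_natl coefMn mulrn_wge0.
have d1 : d.[1] = (1 - r.[1]) ^+ 2.
  by rewrite /d one_sub_sqrt_gap !hornerE; ring.
have [_ Sr] := bisos_horner_nneg Sx S1x r0.
have [Sd Sd1] := bisos_horner_nneg Sx S1x d0.
pose T := horner_alg x (1 - r).
have ST : S T.
  have -> : T = (1 - r.[1])%:A + (r.[1]%:A - horner_alg x r).
    by rewrite addrA -scalerDl subrK scale1r /T rmorphB rmorph1.
  apply: bisosD => //; apply: bisosZ; last exact: bisos1.
  by have [] := one_sub_sqrt1 R k.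
have T2 : T ^+ 2 = 1 - x + horner_alg x d.
  have <- : horner_alg x (1 - 'X) = 1 - x by rewrite rmorphB rmorph1 /= horner_algX.
  by rewrite -rmorphD /d one_sub_sqrt_gap addrC subrK rmorphXn.
have alphaE : (b * T) ^+ 2 = t ^+ 2 + b ^+ 2 * horner_alg x d.
  by rewrite exprMn_comm; [rewrite T2 mulrDr bx|apply: comm => //; exact: bisos_bicommutant].
have Sb2 : S (b ^+ 2) by exact: bisos_sqr.
exists (b * T); split; first exact: bisosM.
  by rewrite alphaE addrC addKr; exact: bisosM.
rewrite alphaE errE opprD addrACA subrr add0r.
have -> : e *: b ^+ 2 - b ^+ 2 * horner_alg x d =
    b ^+ 2 * ((e - d.[1])%:A + (d.[1]%:A - horner_alg x d)).
  by rewrite addrA -scalerDl subrK mulrBr -scalerAr mulr1.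
apply: bisosM => //; apply: bisosD => //; apply: bisosZ; last exact: bisos1.
by rewrite subr_ge0 d1.
Qed.

End Approximation.

(** * The noncommutative Motzkin inequality *)

(* By convexity of the [m]-th power, the approximation of [|t|] within [e] satisfies
   [alpha ^+ (2 * m) <= t ^+ (2 * m) + e *: abs_err_pow t m] for [0 <= e <= 1]. *)
Definition abs_err_pow (R : unitRingType) (B : algType R) (t : B) (m : nat) : B :=
  (t ^+ 2 + abs_err t) ^+ m - (t ^+ 2) ^+ m.

Section MotzkinCone.
Context {R : realType} {n : nat}.
Local Notation A := (ratalg R n).

Section Univariate.
Variable j : 'I_n.
Local Notation S := (@bisos R n j).
Local Notation t := (ratX R j).

(** The chord from [a] to [a + b] lies above the power: the gap satisfies [G_(m+1) = a G_m + e b ((a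
    + b)^m - (a + e b)^m)]. *)
Lemma bisos_convexX (e : R) (a b : A) m : 0 <= e <= 1 -> S a -> S b ->
  S (a ^+ m + e *: ((a + b) ^+ m - a ^+ m) - (a + e *: b) ^+ m).
Proof.
move=> /andP[e0 e1] Sa Sb; have Seb : S (e *: b) by exact: bisosZ.
elim: m => [|m IH]; first by rewrite !expr0 subrr scaler0 addr0 subrr; exact: bisos0.
set u := (a + e *: b) ^+ m in IH *; set w := (a + b) ^+ m in IH *.
have Swu : S (w - u).
  apply: bisos_monoX; first exact: bisosD.
  have -> : a + b - (a + e *: b) = (1 - e) *: b.
    by rewrite opprD addrACA subrr add0r scalerBl scale1r.
  by apply: bisosZ => //; rewrite subr_ge0.
have -> : a ^+ m.+1 + e *: ((a + b) ^+ m.+1 - a ^+ m.+1) - (a + e *: b) ^+ m.+1 =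
    a * (a ^+ m + e *: (w - a ^+ m) - u) + e *: b * (w - u).
  rewrite !exprS -/u -/w !mulrDl mulrBr mulrDr -scalerAr !mulrBr -!scalerAl.
  rewrite scalerBr scalerDr !scalerBr opprD !addrA.
  by rewrite [RHS](ACl (1*2*5*3*4*6)).
by apply: bisosD; apply: bisosM.
Qed.

(** One [alpha] serves every [m]: monotonicity bounds [(alpha ^+ 2) ^+ m] by
    [(t ^+ 2 + e *: abs_err t) ^+ m], and convexity bounds this by the chord. *)
Lemma abs_approx_pow (e : R) : 0 < e <= 1 -> exists alpha : A,
  [/\ S alpha, S (alpha ^+ 2 - t ^+ 2) &
    forall m, S ((t ^+ 2) ^+ m + e *: abs_err_pow t m - (alpha ^+ 2) ^+ m)].
Proof.
move=> /andP[e0 e1]; have [alpha [Sa Sat Sta]] := abs_approx j e0.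
exists alpha; split=> // m.
have St2 : S (t ^+ 2) by apply: bisos_sqr; exact: bicommutantX.
have Serr : S (abs_err t).
  apply: bisos_sqr; apply: bisos_bicommutant; apply: bisosZ; first by rewrite invr_ge0.
  exact: bisos_one_addX2.
have Sa2 : S (alpha ^+ 2) by exact: bisosX.
rewrite -[_ - _](subrKA ((t ^+ 2 + e *: abs_err t) ^+ m)).
apply: bisosD; last exact: bisos_monoX.
by apply: bisos_convexX; rewrite // ltW.
Qed.

End Univariate.

Lemma bisos_tracial_cone j (f : A) : bisos j f -> tracial_cone f.
Proof. by move/(tracial_cone_conj 1); rewrite ratstar1 mul1r mulr1. Qed.

(** * Inequalities for the products [f b g b] *)

Section Bivariate.
Variables (i k : 'I_n) (b : A).
Hypothesis bs : ratstar b = b.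
Implicit Types (f g p q u w : A).

(* [mx f g] is biadditive, and cyclically equivalent to a sum of hermitian squares
   when [f] and [g] are sums of squares: it behaves like the function [f(s) * g(t)] of
   two commuting variables. *)
Let mx f g := f * b * g * b.

Let mx_cone f g : bisos k f -> bisos i g -> tracial_cone (mx f g).
Proof.
move=> [s hs ->] Sg; rewrite /mx !mulr_suml big_seq.
apply: big_ind => [||p /hs [ps _]]; [exact: tracial_cone0|exact: tracial_coneD|].
apply: tracial_cone_cyceq (tracial_cone_conj (p * b) Sg).
rewrite ratstarM bs ps; have := cyceqC p (p * b * g * b).
by rewrite expr2 !mulrA.
Qed.

Let mx_cyc f g p q : cyceq (p * f * b * (g * q) * b) (f * b * g * (q * b * p)).
Proof. by have := cyceqC p (f * b * g * q * b); rewrite !mulrA. Qed.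

(** This is [2 X Y <= X^2 + Y^2] for [X = f1 g1] and [Y = f2 g2], from the hermitian square of
    [f1 * b * g1 - f2 * b * g2]. *)
Let mx_cross f1 f2 g1 g2 : bicommutant k f1 -> bicommutant k f2 ->
  bicommutant i g1 -> bicommutant i g2 ->
  2 *: mx (f1 * f2) (g1 * g2) <~ mx (f1 ^+ 2) (g1 ^+ 2) + mx (f2 ^+ 2) (g2 ^+ 2).
Proof.
move=> C1 C2 D1 D2; have := tracial_cone_sqr (f1 * b * g1 - f2 * b * g2).
rewrite ratstarB !ratstarM bs C1.1 C2.1 D1.1 D2.1 mulrBl !mulrBr.
apply: tracial_cone_cyceq.
have -> : mx (f1 ^+ 2) (g1 ^+ 2) + mx (f2 ^+ 2) (g2 ^+ 2) - 2 *: mx (f1 * f2) (g1 * g2) =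
  mx (f1 ^+ 2) (g1 ^+ 2) - mx (f1 * f2) (g1 * g2) -
  (mx (f1 * f2) (g1 * g2) - mx (f2 ^+ 2) (g2 ^+ 2)).
  by rewrite opprB scaler_nat mulr2n opprD addrACA addrA addrAC -!addrA.
apply: cyceqB; apply: cyceqB.
- by have := mx_cyc f1 g1 f1 g1; rewrite /mx !expr2 !mulrA.
- rewrite (bicommutant_comm C1 C2).
  by have := mx_cyc f1 g1 f2 g2; rewrite /mx !mulrA.
- rewrite (bicommutant_comm D1 D2).
  by have := mx_cyc f2 g2 f1 g1; rewrite /mx !mulrA.
by have := mx_cyc f2 g2 f2 g2; rewrite /mx !expr2 !mulrA.
Qed.

(** In commuting variables the difference of the sides is [c a (c - a)^2]. *)
Let mx_weighted c a : bisos k c -> bisos i a ->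
  2 *: mx (c ^+ 2) (a ^+ 2) <~ mx (c ^+ 3) a + mx c (a ^+ 3).
Proof.
move=> Sc Sa; have [Cc Ca] := (bisos_bicommutant Sc, bisos_bicommutant Sa).
(* [Psi u w] stands for [u w (c - a)^2]. Being biadditive, it reduces to [u = p^2] and [w = q^2],
   where [mx_cross] applies with [X = p c q] and [Y = p q a]. *)
pose Psi u w := mx (u * c ^+ 2) w + mx u (w * a ^+ 2) - 2 *: mx (u * c) (w * a).
have addrACA3 (x1 x2 y1 y2 z1 z2 : A) :
    x1 + x2 + (y1 + y2) - (z1 + z2) = x1 + y1 - z1 + (x2 + y2 - z2).
  by rewrite opprD (addrACA x1) [LHS]addrACA.
have Psi0l w : Psi 0 w = 0 by rewrite /Psi /mx !mul0r scaler0 subr0 addr0.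
have Psi0r u : Psi u 0 = 0 by rewrite /Psi /mx !(mul0r, mulr0) scaler0 subr0 addr0.
have PsiDl w : {morph Psi^~ w : u u' / u + u'}.
  move=> u u'; rewrite /Psi /mx !mulrDl scalerDr.
  exact: addrACA3.
have PsiDr u : {morph Psi u : w w' / w + w'}.
  move=> w w'; rewrite /Psi /mx !(mulrDl, mulrDr) scalerDr.
  exact: addrACA3.
have Psi_sqr p q : bicommutant k p -> bicommutant i q -> tracial_cone (Psi (p ^+ 2) (q ^+ 2)).
  move=> Cp Cq; have Cpc := bicommutantM Cp Cc; have Cqa := bicommutantM Cq Ca.
  have := mx_cross Cpc Cp Cq Cqa; rewrite /tracial_le !exprMn_comm; last first.
  - exact: bicommutant_comm Cp Cc.
  - exact: bicommutant_comm Cq Ca.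
  by rewrite -mulrA (bicommutant_comm Cc Cp) mulrA -expr2 mulrA -expr2.
suff Psi_cone u w : bisos k u -> bisos i w -> tracial_cone (Psi u w).
  by have := Psi_cone _ _ Sc Sa; rewrite /Psi -!expr2 -!exprS.
move=> [s hs ->] [r hr ->].
rewrite (big_morph (Psi^~ _) (PsiDl _) (Psi0l _)) big_seq.
apply: big_ind => [||p /hs Cp]; [exact: tracial_cone0|exact: tracial_coneD|].
rewrite (big_morph (Psi _) (PsiDr _) (Psi0r _)) big_seq.
by apply: big_ind => [||q /hr Cq]; [exact: tracial_cone0|exact: tracial_coneD|exact: Psi_sqr].
Qed.

(** With [s = c] and [t = a], [E3] doubled and [E4] are the parts [2 s t (s - t)^2] and
    [t^2 (s - t)^2] of [t (s - t)^2 (2 s + t)]; [E1] and [E2] bound the mixed term [2 s^3 t]. *)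
Lemma motzkin_tracial_ge0 c a : bisos k c -> bisos i a ->
  3 *: mx (c ^+ 2) (a ^+ 2) <~ (c ^+ 2) ^+ 3 + (b ^+ 2 * a ^+ 2 * b ^+ 2 + b * (a ^+ 2) ^+ 2 * b).
Proof.
move=> Sc Sa; have [Cc Ca] := (bisos_bicommutant Sc, bisos_bicommutant Sa).
have E1 : 2 *: mx (c ^+ 3) a <~ (c ^+ 2) ^+ 3 + a * b ^+ 2 * a * b ^+ 2.
  have := tracial_cone_sqr (c ^+ 3 - b * a * b).
  rewrite ratstarB (bicommutantX_exp 3 Cc).1 !ratstarM bs Ca.1 mulrBl !mulrBr.
  apply: tracial_cone_cyceq.
  have -> : (c ^+ 2) ^+ 3 + a * b ^+ 2 * a * b ^+ 2 - 2 *: mx (c ^+ 3) a =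
      (c ^+ 2) ^+ 3 - mx (c ^+ 3) a - (mx (c ^+ 3) a - a * b ^+ 2 * a * b ^+ 2).
    by rewrite opprB scaler_nat mulr2n opprD addrACA addrA addrAC -!addrA.
  apply: cyceqB; apply: cyceqB.
  - by rewrite -exprM -exprD; exact: cyceq_refl.
  - by rewrite /mx !mulrA; exact: cyceq_refl.
  - by have := cyceqC (c ^+ 3) (b * a * b); rewrite /mx !mulrA.
  by have := cyceqC (a * b * b * a * b) b; rewrite !expr2 !mulrA.
have E2 : a * b ^+ 2 * a * b ^+ 2 <~ b ^+ 2 * a ^+ 2 * b ^+ 2.
  apply: tracial_le_trans (tracial_commutator Ca.1 _) _.
    by rewrite expr2 ratstarM bs.
  apply: tracial_le_cyceq; have := cyceqC (a ^+ 2 * b ^+ 2) (b ^+ 2).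
  by rewrite [(b ^+ 2) ^+ 2]expr2 !mulrA.
have E3 := mx_weighted Sc Sa.
have E4 : 2 *: mx c (a ^+ 3) <~ mx (c ^+ 2) (a ^+ 2) + b * (a ^+ 2) ^+ 2 * b.
  have := mx_cross Cc (bicommutant1 k) Ca (bicommutantX_exp 2 Ca).
  by rewrite mulr1 -exprS expr1n -exprM [mx 1 _]/mx mul1r exprM.
move: E1 E3 E4; move: (mx _ _) (mx _ _) (mx _ _) => m31 m22 m13 E1 E3 E4.
(* The left side becomes [4 m22], twice that of [E3]; [E4] returns the extra [m22]. *)
apply: (@tracial_leD2r _ _ m22).
have -> : 3 *: m22 + m22 = 2 *: (2 *: m22) by rewrite !scaler_nat -mulrSr -mulrnA.
apply: tracial_le_trans (tracial_leZ _ E3) _ => //; rewrite scalerDr.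
have -> : (c ^+ 2) ^+ 3 + (b ^+ 2 * a ^+ 2 * b ^+ 2 + b * (a ^+ 2) ^+ 2 * b) + m22 =
    (c ^+ 2) ^+ 3 + b ^+ 2 * a ^+ 2 * b ^+ 2 + (m22 + b * (a ^+ 2) ^+ 2 * b).
  by rewrite -!addrA [_ * b + m22]addrC.
apply: tracial_leD => //; apply: tracial_le_trans E1 _.
exact: tracial_leD (tracial_le_refl _) E2.
Qed.

(** [motzkin_tracial_ge0] is applied to approximants of [|c|] and [|a|] from above: its left side
    then dominates [3 a b c^2 b a], and its right side grows by at most [e] times a fixed
    polynomial. *)
Lemma motzkin_perturbed (e : R) (a := ratX R i) (c := ratX R k) : 0 < e <= 1 ->
  3 *: (a * b * c ^+ 2 * b * a) <~
  b ^+ 2 * a ^+ 2 * b ^+ 2 + a ^+ 2 * b ^+ 2 * a ^+ 2 + c ^+ 6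
  + e *: (b ^+ 2 * abs_err_pow a 1 * b ^+ 2 + b * abs_err_pow a 2 * b + abs_err_pow c 3).
Proof.
move=> e01.
have [alpha [Sa Saa ha]] := @abs_approx_pow i e e01.
have [gamma [Sc Scc hc]] := @abs_approx_pow k e e01.
rewrite -/a -/c in Saa ha Scc hc.
have Sc2 : bisos k (c ^+ 2) by apply: bisos_sqr; exact: bicommutantX.
have low : 3 *: (a * b * c ^+ 2 * b * a) <~ 3 *: mx (gamma ^+ 2) (alpha ^+ 2).
  apply: tracial_leZ => //; apply: (@tracial_le_trans _ _ (mx (c ^+ 2) (a ^+ 2))).
    apply: tracial_le_cyceq; have := cyceqC (a * b) (c ^+ 2 * b * a).
    by rewrite /mx expr2 !mulrA.
  rewrite /tracial_le; have -> : mx (gamma ^+ 2) (alpha ^+ 2) - mx (c ^+ 2) (a ^+ 2) =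
      mx (gamma ^+ 2 - c ^+ 2) (alpha ^+ 2) + mx (c ^+ 2) (alpha ^+ 2 - a ^+ 2).
    by rewrite /mx !(mulrBl, mulrBr) addrA subrK.
  by apply: tracial_coneD; apply: mx_cone => //; exact: bisosX.
apply: tracial_le_trans low _; apply: tracial_le_trans (motzkin_tracial_ge0 Sc Sa) _.
have conj_le m u : bisos i m -> ratstar u = u -> tracial_cone (u * m * u).
  by move=> Sm us; have := tracial_cone_conj u Sm; rewrite us.
have b2s : ratstar (b ^+ 2) = b ^+ 2 by rewrite expr2 ratstarM bs.
have hi1 : b ^+ 2 * alpha ^+ 2 * b ^+ 2 <~
    b ^+ 2 * a ^+ 2 * b ^+ 2 + e *: (b ^+ 2 * abs_err_pow a 1 * b ^+ 2).
  have := conj_le _ _ (ha 1%N) b2s; rewrite !expr1 mulrBr mulrDr mulrBl mulrDl.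
  by rewrite -scalerAr -scalerAl.
have hi2 : b * (alpha ^+ 2) ^+ 2 * b <~
    a ^+ 2 * b ^+ 2 * a ^+ 2 + e *: (b * abs_err_pow a 2 * b).
  apply: (@tracial_le_trans _ _ (b * (a ^+ 2) ^+ 2 * b + e *: (b * abs_err_pow a 2 * b))).
    have := conj_le _ _ (ha 2) bs; rewrite mulrBr mulrDr mulrBl mulrDl.
    by rewrite -scalerAr -scalerAl.
  apply: tracial_leD; last exact: tracial_le_refl.
  apply: tracial_le_cyceq; have := cyceqC (b * a ^+ 2) (a ^+ 2 * b).
  by rewrite [(a ^+ 2) ^+ 2]expr2 [b ^+ 2]expr2 !mulrA.
have hi3 : (gamma ^+ 2) ^+ 3 <~ c ^+ 6 + e *: abs_err_pow c 3.
  by have := bisos_tracial_cone (hc 3); rewrite -(exprM c).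
apply: tracial_le_trans (tracial_leD hi3 (tracial_leD hi1 hi2)) _.
move: (abs_err_pow a 1) (abs_err_pow a 2) (abs_err_pow c 3) => p1 p2 p3.
rewrite !scalerDr !addrA [X in X <~ _](ACl (3*5*1*4*6*2)).
exact: tracial_le_refl.
Qed.

End Bivariate.
End MotzkinCone.

(** * Closure in the finest locally convex topology *)

(** A balanced absorbing set contains all small multiples of the fixed direction [k]. *)
Lemma closure_finest_lc (R : realType) (V : lmodType R) (K : set V) (h k : V) :
  (forall e : R, 0 < e <= 1 -> K (h + e *: k)) ->
  closure (K : set (finest_lc V)) h.
Proof.
move=> hK U /flc_nbhsP[W [cW bW aW] WU].
have [r r0 Wr] := absorbing_le bW aW k.
pose e := Num.min r 1; have e0 : 0 < e by rewrite lt_min r0 ltr01.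
exists (h + e *: k); split; first by apply: hK; rewrite e0 ge_min lexx orbT.
by apply/WU/Wr; rewrite gtr0_norm // ge_min lexx.
Qed.

Section Closure.
Context {R : realType} {n : nat}.
Local Notation F := (ncpoly R 'I_n).
Implicit Types (p q : F).

Lemma ncstarXn p m : ncstar (p ^+ m) = ncstar p ^+ m.
Proof.
elim: m => [|m IH]; first by rewrite !expr0 ncstar1.
by rewrite exprS exprSr ncstarM IH.
Qed.

Lemma ncstarZ (c : R) p : ncstar (c *: p) = c *: ncstar p.
Proof. exact: linearZ. Qed.

Lemma ncstarB p q : ncstar (p - q) = ncstar p - ncstar q.
Proof. exact: raddfB. Qed.

Lemma ncstar_motzkin (i j k : 'I_n) :
  ncstar (motzkin (ncX i) (ncX j) (ncX k) : F) = motzkin (ncX i) (ncX j) (ncX k).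
Proof.
rewrite /motzkin !mulr_natl -!scaler_nat ncstarB !ncstarD ncstarZ !(ncstarXn, ncstarM, ncstarX).
by rewrite !mulrA.
Qed.

Lemma ncstar_abs_err_pow (i : 'I_n) m : ncstar (abs_err_pow (ncX i : F) m) = abs_err_pow (ncX i) m.
Proof.
by rewrite /abs_err_pow /abs_err ncstarB !ncstarXn ncstarD !ncstarXn ncstarZ ncstarD ncstar1
  ncstarXn ncstarX.
Qed.

Lemma ratembed_abs_err_pow (i : 'I_n) m : ratembed (abs_err_pow (ncX i : F) m) = abs_err_pow (ratX R i) m.
Proof.
rewrite /abs_err_pow /abs_err rmorphB !rmorphXn rmorphD !rmorphXn /= linearZ rmorphD rmorph1 rmorphXn /=.
by rewrite /ratembed ncevalX.
Qed.

Lemma motzkin_in_closure (h : ncsa R n) (i1 i2 i3 : 'I_n) :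
  val h = motzkin (ncX i1) (ncX i2) (ncX i3) ->
  closure (coneK R n : set (finest_lc (ncsa R n))) h.
Proof.
move=> hE.
pose a : F := ncX i1; pose b : F := ncX i2; pose c : F := ncX i3.
(* The error term of [motzkin_perturbed], lifted to the free algebra and independent of [e]. *)
pose k0 : F := b ^+ 2 * abs_err_pow a 1 * b ^+ 2 + b * abs_err_pow a 2 * b + abs_err_pow c 3.
have k0s : k0 \in @selfadjoint R n.
  apply/eqP; rewrite /k0 2!ncstarD !(ncstar_abs_err_pow, ncstarXn, ncstarM, ncstarX).
  by rewrite !mulrA.
apply: (@closure_finest_lc _ _ _ _ (exist _ k0 k0s : ncsa R n)) => e e01.
suff : tracial_cone (ratembed (val h + e *: k0)) by [].
have [h1 h2 h3] : [/\ ratembed a = ratX R i1, ratembed b = ratX R i2 & ratembed c = ratX R i3].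
  by split; rewrite /ratembed ncevalX.
have := @motzkin_perturbed R n i1 i3 (ratX R i2) (ratstarX i2) e e01.
rewrite /tracial_le; congr tracial_cone.
rewrite hE rmorphD /= [ratembed (e *: _)]linearZ [X in _ = X + _]rmorph_motzkin /= h1 h2 h3.
rewrite /k0 2!rmorphD /= !(ratembed_abs_err_pow, rmorphXn, rmorphM) /= h2 !ratembed_abs_err_pow.
by rewrite /motzkin mulr_natl scaler_nat addrAC.
Qed.
End Closure.

Theorem proposition6p8 (R : realType) (n : nat) (n3 : (3 <= n)%N) :
  let x (k : 'I_3) : ncpoly R 'I_n := ncX (widen_ord n3 k) in
  let x1 := x 0 in let x2 := x 1 in let x3 := x 2 in
  exists2 h : ncsa R n,
    val h = x2 ^+ 2 * x1 ^+ 2 * x2 ^+ 2 + x1 ^+ 2 * x2 ^+ 2 * x1 ^+ 2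
            + x3 ^+ 6 - 3%:R *: (x1 * x2 * x3 ^+ 2 * x2 * x1) &
    (closure (coneK R n : set (finest_lc (ncsa R n))) `\` coneK R n) h.
Proof.
move=> x x1 x2 x3.
have hs : motzkin x1 x2 x3 \in @selfadjoint R n by apply/eqP; exact: ncstar_motzkin.
exists (exist (fun p => p \in @selfadjoint R n) _ hs : ncsa R n).
  by rewrite /= /motzkin mulr_natl -scaler_nat.
split; first exact: motzkin_in_closure.
by apply: (@motzkin_notin_coneK R n _ (widen_ord n3 0) (widen_ord n3 1) (widen_ord n3 2)).
Qed.
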